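(* Let $p\in(1,\infty)$, $\frac1p+\frac1{p'}=1$, $\alpha\in(-\frac1p,\frac1{p'})$ and let $k\ge1$ be an integer. Let $X,U,Y$ be Banach spaces, let $T(\cdot)$ be a bounded analytic semigroup on $X$ with generator $-A$, and let $C\in B(X_k,Y)$ and $B\in B(U,X_{-k})$ be such that for some constant $M>0$ $$\|CT_{-k}(t)B\|_{U\to Y}\le \frac Mt\qquad(t>0).$$ Then $\mathcal F^\alpha:=CT_{-k}(\cdot)B\,*$ is bounded $L^p_\alpha(\mathbb R_+,U)\to L^p_\alpha(\mathbb R_+,Y)$ if and only if $\mathcal F=\mathcal F^0$ is bounded $L^p(\mathbb R_+,U)\to L^p(\mathbb R_+,Y)$.
   Context: For an integer $k\ge 1$, $X_k=X_k(A)$ is $\mathcal D(A^k)$ with norm $\|(\mathrm{Id}+A)^k\cdot\|_X$, and $X_{-k}$ is the completion of $X$ for the norm $\|(\mathrm{Id}+A)^{-k}\cdot\|_X$. $T(\cdot)$ extends to a bounded strongly continuous semigroup $T_{-k}(\cdot)$ on $X_{-k}$ (written simply $T(\cdot)$ when no confusion arises). By analyticity $T_{-k}(t)X_{-k}\subseteq X_k$ for $t>0$, so $CT_{-k}(t)B$ is a well-defined bounded operator $U\to Y$ for each $t>0$. $\mathbb R_+=(0,\infty)$ and $L^p_\alpha(\mathbb R_+,E)=\{f:\mathbb R_+\to E:\ t\mapsto t^\alpha f(t)\in L^p(\mathbb R_+,E)\}$ with norm $\|t^\alpha f\|_{L^p}$. The operators $\mathcal F^\alpha$ and $\mathcal F$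 are the same convolution operator with operator-valued kernel $t\mapsto CT_{-k}(t)B$ on $(0,\infty)$, i.e. $u\mapsto CT_{-k}(\cdot)B*u$ with $(CT_{-k}(\cdot)B*u)(t)=\int_0^tCT_{-k}(t-s)Bu(s)\,ds$, considered on $L^p_\alpha(\mathbb R_+,U)$ and on $L^p(\mathbb R_+,U)$ respectively. *)

(* Defs.v *)
From HB Require Import structures.
From mathcomp Require Import all_boot all_order all_algebra.
From mathcomp Require Import all_classical all_reals all_analysis.
From mathcomp Require Import complex.
Set Implicit Arguments.
Unset Strict Implicit.
Unset Printing Implicit Defensive.
Import Order.TTheory GRing.Theory Num.Theory.
Import numFieldNormedType.Exports.
Local Open Scope classical_set_scope.
Local Open Scope ring_scope.
Local Open Scope complex_scope.

(* Banach spaces are complete normed modules over R[i] (holomorphy needs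
   complex scalars).  Their library norm takes values in R[i]; [rnorm] is the
   same number read in R. *)
Definition rnorm (R : realType) (E : normedModType R[i]) (x : E) : R :=
  complex.Re `|x|.

Definition bounded_linear (R : realType) (E F : normedModType R[i])
    (f : E -> F) : Prop :=
  linear f /\ exists c : R, forall x, rnorm (f x) <= c * rnorm x.

Section Semigroups.
Variables (R : realType) (E : normedModType R[i]).

(* A semigroup is a family indexed by R of which only the values at t >= 0
   are meaningful. *)
Definition C0_semigroup (T : R -> E -> E) : Prop :=
  [/\ forall t, 0 <= t -> bounded_linear (T t),
      forall x, T 0 x = x,
      forall s t, 0 <= s -> 0 <= t -> forall x, T (s + t) x = T s (T t x) &
      forall x, T t x @[t --> 0^'+] --> x].

Definition bounded_semigroup (T : R -> E -> E) : Prop :=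
  exists M : R, forall t, 0 <= t -> forall x, rnorm (T t x) <= M * rnorm x.

(* {z <> 0 : |arg z| < theta} *)
Definition sector (theta : R) : set R[i] :=
  [set z | exists r phi : R, [/\ 0 < r, `|phi| < theta &
             z = (r * cos phi) +i* (r * sin phi)]].

(* T extends to a holomorphic semigroup on some sector of half-angle
   theta <= pi/2, bounded and strongly continuous at 0 on every smaller
   sector. *)
Definition bounded_analytic_semigroup (T : R -> E -> E) : Prop :=
  C0_semigroup T /\ bounded_semigroup T /\
  exists (theta : R) (S : R[i] -> E -> E),
    0 < theta <= pi / 2 /\
    [/\ forall t : R, 0 < t -> S t%:C = T t,
        forall z, sector theta z -> bounded_linear (S z),
        forall z w, sector theta z -> sector theta w ->
          forall x, S (z + w) x = S z (S w x),
        forall x z, sector theta z ->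
          derivable (fun w : R[i]^o => S w x) z 1 &
        forall theta' : R, 0 < theta' < theta ->
          (exists M : R, forall z, sector theta' z ->
             forall x, rnorm (S z x) <= M * rnorm x) /\
          (forall x, S z x @[z --> within (sector theta') (nbhs (0 : R[i]^o))]
             --> x)].

(* Unbounded operators are represented by their graphs. *)
Definition generator (T : R -> E -> E) (x y : E) : Prop :=
  (h^-1)%:C *: (T h x - x) @[h --> 0^'+] --> y.

Definition id_plus (A : E -> E -> Prop) (x y : E) : Prop := A x (y - x).

Fixpoint op_pow (A : E -> E -> Prop) (k : nat) (x y : E) : Prop :=
  if k is k'.+1 then exists2 z, op_pow A k' x z & A z y else x = y.

Definition op_dom (A : E -> E -> Prop) : set E := [set x | exists y, A x y].

End Semigroups.

(* C is in B(X_k, Y), where X_k = D(A^k) with norm ||(Id + A)^k . ||.  The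
   values of the total function C outside D(A^k) are irrelevant. *)
Definition bounded_on_Xk (R : realType) (X Y : normedModType R[i])
    (A : X -> X -> Prop) (k : nat) (C : X -> Y) : Prop :=
  (forall (a : R[i]) (x x' : X), op_dom (op_pow A k) x ->
     op_dom (op_pow A k) x' -> C (a *: x + x') = a *: C x + C x') /\
  exists c : R, forall x y, op_dom (op_pow A k) x ->
    op_pow (id_plus A) k x y -> rnorm (C x) <= c * rnorm y.

(* The Banach space Z with the map iota is a completion of X for the norm
   ||(Id + A)^(-k) . ||; here y = (Id + A)^(-k) x is written
   (Id + A)^k y = x. *)
Definition is_Xmk (R : realType) (X : normedModType R[i])
    (A : X -> X -> Prop) (k : nat) (Z : completeNormedModType R[i])
    (iota : X -> Z) : Prop :=
  [/\ linear iota, dense (range iota) &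
      forall x, exists2 y, op_pow (id_plus A) k y x & rnorm (iota x) = rnorm y].

(* u |-> C T_{-k}(t) B u, where Tm is T_{-k}: the operator C is applied to the
   element of X_k which iota identifies with T_{-k}(t) B u. *)
Definition CTB (R : realType) (X Z U Y : normedModType R[i])
    (A : X -> X -> Prop) (k : nat) (iota : X -> Z) (Tm : R -> Z -> Z)
    (C : X -> Y) (B : U -> Z) (t : R) (u : U) : Y :=
  C (xget 0 [set x | op_dom (op_pow A k) x /\ iota x = Tm t (B u)]).

Section Bochner.
Variables (d : measure_display) (T : measurableType d) (R : realType).
Variables (mu : {measure set T -> \bar R}) (E : normedModType R[i]).

Definition simple_function (s : T -> E) : Prop :=
  finite_set (range s) /\ forall y, measurable (s @^-1` [set y]).

Definition strongly_measurable (D : set T) (f : T -> E) : Prop :=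
  exists s : nat -> T -> E, (forall n, simple_function (s n)) /\
    {ae mu, forall x, D x -> s n x @[n --> \oo] --> f x}.

Definition integrable_simple (D : set T) (s : T -> E) : Prop :=
  simple_function s /\
  forall y, y != 0 -> (mu (D `&` s @^-1` [set y]) < +oo)%E.

Definition simple_integral (D : set T) (s : T -> E) : E :=
  \sum_(y \in range s) (fine (mu (D `&` s @^-1` [set y])))%:C *: y.

(* f is Bochner integrable on D with integral v. *)
Definition is_bochner_integral (D : set T) (f : T -> E) (v : E) : Prop :=
  strongly_measurable D f /\
  exists s : nat -> T -> E,
    [/\ forall n, integrable_simple D (s n),
        (\int[mu]_(x in D) (rnorm (f x - s n x))%:E)%E @[n --> \oo] --> 0%E &
        simple_integral D (s n) @[n --> \oo] --> v].

End Bochner.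

Section WeightedLp.
Variable R : realType.
Local Notation leb := (@lebesgue_measure R).
Local Notation Rplus := (`]0, +oo[%classic : set R).

Definition Lp_norm (E : normedModType R[i]) (p : R) (f : R -> E) : \bar R :=
  ('N[leb]_p%:E [ (fun t => (rnorm (f t))%:E) \_ Rplus ])%E.

Definition in_Lp (E : normedModType R[i]) (p : R) (f : R -> E) : Prop :=
  strongly_measurable leb Rplus f /\ (Lp_norm p f < +oo)%E.

Definition weighted (E : normedModType R[i]) (alpha : R) (f : R -> E) (t : R)
    : E := (t `^ alpha)%:C *: f t.

Definition in_Lpw (E : normedModType R[i]) (p alpha : R) (f : R -> E) : Prop :=
  in_Lp p (weighted alpha f).

Definition Lpw_norm (E : normedModType R[i]) (p alpha : R) (f : R -> E)
    : \bar R := Lp_norm p (weighted alpha f).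

(* (K * u)(t) = \int_0^t K(t - s) u(s) ds has value y.  The kernels considered
   are only O(1/t) at 0, so that in general the integral does not converge
   absolutely at s = t; it is improper there, that is, the limit for e -> 0+
   of the Bochner integrals over (0, t - e). *)
Definition is_convolution_at (U Y : normedModType R[i]) (K : R -> U -> Y)
    (u : R -> U) (t : R) (y : Y) : Prop :=
  exists J : R -> Y,
    (forall e, 0 < e < t ->
       is_bochner_integral leb `]0, (t - e)%R[ (fun s => K (t - s) (u s)) (J e))
    /\ J e @[e --> 0^'+] --> y.

Definition bounded_convolution (U Y : normedModType R[i]) (p alpha : R)
    (K : R -> U -> Y) : Prop :=
  exists c : R, forall u : R -> U, in_Lpw p alpha u ->
    exists v : R -> Y,
      [/\ {ae leb, forall t, 0 < t -> is_convolution_at K u t (v t)},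
          in_Lpw p alpha v &
          (Lpw_norm p alpha v <= c%:E * Lpw_norm p alpha u)%E].

End WeightedLp.

(* Main.v *)
Require Import Defs.
From mathcomp Require Import all_boot all_order all_algebra.
From mathcomp Require Import all_classical all_reals all_analysis.
From mathcomp Require Import complex measurable_realfun ring lra.

(* Write K for the kernel C T_{-k}(.) B and let g = b - a be the difference of two
   weights below 1 - 1/p.  For u in L^p_b put u' = s^g u, which lies in L^p_a with
   the same norm, and v' = K * u'.  Then

     (K * u)(t) = t^(-g) v'(t) + \int_0^t K(t - s) (1 - (s / t)^g) u(s) ds.

   The first term has the required norm.  Since |1 - x^g| <= n (1 - x) (1 + x^g) for
   n >= |g|, the factor 1 - (s / t)^g cancels the singularity M / (t - s) of K, and
   the second term is dominated by (n M / t) \int_0^t (1 + (s / t)^g) |u(s)| ds.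
   This is a sum of two Hardy operators, which are bounded on the weighted space.
   The theorem is the case where (a, b) is (alpha, 0) or (0, alpha). *)

Set Implicit Arguments.
Unset Strict Implicit.
Unset Printing Implicit Defensive.
Import Order.TTheory GRing.Theory Num.Theory.
Import numFieldNormedType.Exports.
Local Open Scope classical_set_scope.
Local Open Scope ring_scope.

(** Two obstacles shape the details. No measurability of the kernel in [t] is given, so that of the
    integrands [K (t - s) (u s)] is extracted from the convolutions which the hypothesis provides.
    Moreover the correction term is produced for each [t] separately, by choice, so the
    decomposition does not show that the convolution is measurable in [t]; this comes from
    truncations of [u], which lie in [L^p_a]. For the same reason some norms are estimated through
    integrals of nonnegative functions not known to be measurable; such integrals are still monotone
    under almost everywhere inequalities. The power [s^g] passes through [K] because [K t] is
    homogeneous. For [CTB] this rests on the injectivity of [iota], which fixes the preimage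
    selected by [xget]. The convolution is improper at [s = t], whereas the correction converges
    absolutely; absolute continuity of the integral makes its two readings agree. That both weights
    lie below [1 - 1/p] makes [s^(-a)] and [s^(-b)] integrable at 0 to the power [p']: this gives
    the integrability of [u] and [s^g u] on [(0, t)] as well as Hardy's bounds. *)

Section RealNorm.
Context {R : realType} {E : normedModType R[i]}.
Implicit Types (x y : E) (a : R).
Local Open Scope complex_scope.

(** The order of [R[i]] compares only numbers with equal imaginary parts, so a nonnegative norm is
    real and [rnorm] loses nothing. *)
Lemma rnormE x : `|x| = (rnorm x)%:C.
Proof.
have := normr_ge0 x; rewrite /rnorm.
by case: `|x| => a b; rewrite lecE /= => /andP[/eqP ->].
Qed.

Lemma rnorm_ge0 x : 0 <= rnorm x.
Proof. by have := normr_ge0 x; rewrite rnormE lecR. Qed.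

Lemma rnorm0 : rnorm (0 : E) = 0.
Proof. by rewrite /rnorm normr0. Qed.

Lemma rnorm_eq0 x : (rnorm x == 0) = (x == 0).
Proof.
rewrite -[RHS]normr_eq0 rnormE; apply/eqP/eqP => [->//|].
by move/(congr1 (@complex.Re R)).
Qed.

Lemma rnormB x y : rnorm (x - y) = rnorm (y - x).
Proof. by rewrite /rnorm distrC. Qed.

Lemma rnormD x y : rnorm (x + y) <= rnorm x + rnorm y.
Proof. by have := ler_normD x y; rewrite !rnormE -rmorphD lecR. Qed.

Lemma rnorm_triangle z x y : rnorm (x - y) <= rnorm (x - z) + rnorm (z - y).
Proof. by rewrite -[in leLHS](subrK z x) -addrA rnormD. Qed.

Lemma rnorm_le_dist x y : rnorm x <= rnorm (x - y) + rnorm y.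
Proof. by rewrite -[in leLHS](subrK y x) rnormD. Qed.

Lemma rnorm_dist x y : `|rnorm x - rnorm y| <= rnorm (x - y).
Proof.
have h1 := rnorm_le_dist x y; have h2 := rnorm_le_dist y x.
rewrite (rnormB y) in h2; rewrite ler_norml; lra.
Qed.

Lemma rnormZ a x : rnorm (a%:C *: x) = `|a| * rnorm x.
Proof. by rewrite /rnorm normrZ rnormE normc_def /= expr0n addr0 sqrtr_sqr mul0r subr0. Qed.

Lemma cvg_rnormP {T : Type} {F : set_system T} {FF : Filter F} (f : T -> E) l :
  f x @[x --> F] --> l <-> rnorm (f x - l) @[x --> F] --> (0 : R).
Proof.
split.
  move/cvgrPdist_lt => h; apply/cvgrPdist_lt => e e0.
  have e0' : 0 < e%:C by rewrite ltcR.
  have := h _ e0'; apply: filterS => t.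
  by rewrite sub0r normrN rnormE ltcR rnormB ger0_norm ?rnorm_ge0.
move/cvgrPdist_lt => h; apply/cvgrPdist_lt => -[e e'].
(* The radius lives in [R[i]]; being positive, it is real. *)
rewrite ltcE/= => /andP[/eqP -> e0].
have := h _ e0; apply: filterS => t.
by rewrite sub0r normrN rnormE ltcR rnormB ger0_norm ?rnorm_ge0.
Qed.

Lemma cvg_rnorm {T : Type} {F : set_system T} {FF : Filter F} (f : T -> E) l :
  f x @[x --> F] --> l -> rnorm (f x) @[x --> F] --> rnorm l.
Proof.
move=> /cvg_rnormP /cvgrPdist_lt h; apply/cvgrPdist_lt => e /h.
apply: filterS => t; rewrite sub0r normrN (ger0_norm (rnorm_ge0 _)).
by rewrite rnormB; exact/le_lt_trans/rnorm_dist.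
Qed.

Lemma cvg_rdist {T : Type} {F : set_system T} {FF : Filter F} (f : T -> E) l y :
  f x @[x --> F] --> l -> rnorm (f x - y) @[x --> F] --> rnorm (l - y).
Proof. by move=> fl; apply: cvg_rnorm; apply: cvgB => //; exact: cvg_cst. Qed.

Lemma cvg_scale_real {T : Type} {F : set_system T} {FF : Filter F}
    (a : T -> R) (f : T -> E) (b : R) l :
  a x @[x --> F] --> b -> f x @[x --> F] --> l ->
  (a x)%:C *: f x @[x --> F] --> b%:C *: l.
Proof.
move=> ab fl; apply: cvgZ => //.
apply/cvgrPdist_lt => -[e e']; rewrite ltcE/= => /andP[/eqP -> e0].
move/cvgrPdist_lt : ab => /(_ _ e0); apply: filterS => t.
by rewrite -rmorphB/= normc_def /= expr0n addr0 sqrtr_sqr ltcR.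
Qed.

End RealNorm.

Lemma rnorm_cauchy_cvg {R : realType} {E : completeNormedModType R[i]}
    (f : nat -> E) :
  (forall e : R, 0 < e -> exists N, forall m n, (N <= m)%N -> (N <= n)%N ->
     rnorm (f m - f n) < e) ->
  exists l : E, f n @[n --> \oo] --> l.
Proof.
move=> h; suff fl : cvg (f @ \oo) by exists (lim (f @ \oo)).
apply: cauchy_cvg; apply/cauchy_ballP => -[e e'].
rewrite ltcE/= => /andP[/eqP -> e0].
have [N hN] := h _ e0.
exists (f @` [set n | (N <= n)%N], f @` [set n | (N <= n)%N]) => /=.
  by split; exists N => // n /= Nn; exists n.
by move=> [_ _]/= [[m Nm <-] [n Nn <-]]; rewrite -ball_normE/= rnormE ltcR; exact: hN.
Qed.

(** * Strong measurability *)

Section StrongMeasurability.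
Context {d : measure_display} {T : measurableType d} {R : realType}.
Implicit Types (E F : normedModType R[i]).

Lemma simple_preimage {E} (s : T -> E) (B : set E) :
  simple_function s -> measurable (s @^-1` B).
Proof.
move=> [fs ms].
have -> : s @^-1` B = \bigcup_(z in range s `&` B) s @^-1` [set z].
  apply/seteqP; split=> [t Bt|t [z [_ Bz] /= sz]]; last by rewrite sz.
  by exists (s t) => //; split=> //; exists t.
apply: fin_bigcup_measurable => [|z _]; last exact: ms.
exact: finite_setIl.
Qed.

Lemma simple_cst {E} (y : E) : simple_function (cst y : T -> E).
Proof.
split; first by apply: (sub_finite_set _ (finite_set1 y)) => _ [t _ <-].
by move=> z; rewrite preimage_cst; case: ifP.
Qed.

Lemma simple_comp {E F} (g : E -> F) (s : T -> E) :
  simple_function s -> simple_function (g \o s).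
Proof.
move=> ss; split; last by move=> z; exact: (simple_preimage (g @^-1` [set z]) ss).
by case: ss => fs _; rewrite -(image_comp s g); exact: finite_image fs.
Qed.

Lemma simple_pair {E F} (s : T -> E) (r : T -> F) :
  simple_function s -> simple_function r ->
  simple_function (fun t => (s t, r t) : (E * F)%type).
Proof.
move=> [fs ms] [fr mr]; split.
  apply: (sub_finite_set _ (finite_setX fs fr)) => _ [t _ <-].
  by split; exists t.
move=> [y z]; have -> : (fun t => (s t, r t)) @^-1` [set (y, z)] =
    s @^-1` [set y] `&` r @^-1` [set z].
  by apply/seteqP; split=> t /= [-> ->].
exact: measurableI.
Qed.

Lemma simple_if {E} (A : set T) (s r : T -> E) : measurable A ->
  simple_function s -> simple_function r ->
  simple_function (fun t => if t \in A then s t else r t).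
Proof.
move=> mA [fs ms] [fr mr]; split.
  have fsr : finite_set (range s `|` range r) by rewrite finite_setU.
  apply: (sub_finite_set _ fsr) => _ [t _ <-].
  by case: ifP => _; [left|right]; exists t.
move=> y.
have -> : (fun t => if t \in A then s t else r t) @^-1` [set y] =
    (A `&` s @^-1` [set y]) `|` (~` A `&` r @^-1` [set y]).
  apply/seteqP; split=> t /=.
    by case: ifPn => [|/negP]; rewrite inE => At h; [left|right].
  by case=> -[At <-]; case: ifPn => //; [move/negP|]; rewrite inE.
by apply: measurableU; apply: measurableI => //; exact: measurableC.
Qed.

(* Pettis' criterion, in which the norms of all translates replace the
   functionals. *)
Definition separably_measurable {E} (f : T -> E) : Prop :=
  (forall y, measurable_fun setT (fun t => rnorm (f t - y))) /\
  exists y : nat -> E, forall t (e : R), 0 < e -> exists n, rnorm (f t - y n) < e.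

Local Notation sm := separably_measurable.

Lemma sm_rnorm {E} (f : T -> E) : sm f -> measurable_fun setT (fun t => rnorm (f t)).
Proof. by move=> [/(_ 0) + _]; under eq_fun do rewrite subr0. Qed.

Lemma sm_simple {E} (s : T -> E) : simple_function s -> sm s.
Proof.
move=> ss; split.
  move=> y _ B mB; rewrite setTI.
  exact: (simple_preimage ((fun z => rnorm (z - y)) @^-1` B) ss).
case: ss => /finite_seqP[r sr] _.
exists (nth 0 r) => t e e0; exists (index (s t) r).
have : s t \in r by have : range s (s t) by [exists t]; rewrite sr.
by move=> sr'; rewrite nth_index// subrr rnorm0.
Qed.

Lemma sm_cvg {E} (f : nat -> T -> E) (g : T -> E) :
  (forall n, sm (f n)) -> (forall t, f n t @[n --> \oo] --> g t) -> sm g.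
Proof.
move=> smf fg; split.
  move=> y; apply: (measurable_fun_cvg (h := fun n t => rnorm (f n t - y))).
    by move=> n; case: (smf n).
  by move=> t _; exact: cvg_rdist.
have /choice[y hy] : forall n, exists y : nat -> E,
    forall t (e : R), 0 < e -> exists m, rnorm (f n t - y m) < e.
  by move=> n; case: (smf n).
(* The countably many dense sequences are merged into one through codes of pairs; an index that
   codes no pair gets the harmless value 0. *)
exists (fun k => if unpickle k is Some (n, m) then y n m else 0) => t e e0.
have e20 : 0 < e / 2 by rewrite divr_gt0.
have /cvg_rnormP/cvgrPdist_lt/(_ _ e20)[n _ /(_ n (leqnn _))] := fg t.
rewrite /= sub0r normrN (ger0_norm (rnorm_ge0 _)) rnormB => fn.
have [m ym] := hy n t _ e20; exists (pickle (n, m)); rewrite pickleK.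
by apply: (le_lt_trans (rnorm_triangle (f n t) _ _)); lra.
Qed.

(** Nearest-point selection among 0, [y 0], ..., [y (n - 1)]: the value changes only when the new
    point is strictly nearer, so the error decreases. Since the selection starts at 0, the error is
    at most the norm of [f], which later serves as the dominating function. *)
Lemma sm_approx {E} (f : T -> E) : sm f -> exists s : nat -> T -> E,
  [/\ forall n, simple_function (s n), forall t, s n t @[n --> \oo] --> f t &
      forall n t, rnorm (f t - s n t) <= rnorm (f t)].
Proof.
move=> [mf [y yf]].
pose nearer n (g : T -> E) := [set t | rnorm (f t - y n) < rnorm (f t - g t)].
pose s := fix s n : T -> E :=
  if n is n'.+1 then fun t => if t \in nearer n' (s n') then y n' else s n' t
  else cst 0.
have sS n t : rnorm (f t - s n.+1 t) =
    Num.min (rnorm (f t - y n)) (rnorm (f t - s n t)).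
  rewrite /=; case: ifPn => [|/negP]; rewrite inE /nearer/= => h.
    by rewrite min_l// ltW.
  by rewrite min_r// leNgt; apply/negP.
have ms n : measurable_fun setT (fun t => rnorm (f t - s n t)).
  elim: n => [|n IH]; first exact: mf.
  by under eq_fun do rewrite sS; apply: measurable_minr => //; exact: mf.
have ss n : simple_function (s n).
  elim: n => [|n IH]; first exact: simple_cst.
  apply: simple_if => //; last exact: simple_cst.
  have /(_ measurableT [set true] I) := measurable_fun_ltr (mf (y n)) (ms n).
  by rewrite setTI.
have sdec n m t : rnorm (f t - s (n + m)%N t) <= rnorm (f t - s n t).
  elim: m => [|m IH]; first by rewrite addn0.
  by rewrite addnS sS ge_min IH orbT.
exists s; split=> //; last first.
  by move=> n t; have := sdec 0%N n t; rewrite /= subr0.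
move=> t; apply/cvg_rnormP/cvgrPdist_lt => e e0.
have [N hN] := yf t _ e0.
exists N.+1 => // n /= /subnK <-; rewrite addnC sub0r normrN.
rewrite ger0_norm ?rnorm_ge0// rnormB.
apply: le_lt_trans (sdec _ _ _) _.
by rewrite sS gt_min hN.
Qed.

(** The norms of translates of [h (f t) (g t)] are not accessible from those of [f] and [g]. Simple
    approximations are: a function of a pair of simple functions is simple, and sequential
    continuity of [h] passes to the limit. *)
Lemma sm_comp2 {E F} {G : normedModType R[i]} (h : E -> F -> G) (f : T -> E) (g : T -> F) :
  (forall (u : nat -> E) (v : nat -> F) x y, u n @[n --> \oo] --> x ->
     v n @[n --> \oo] --> y -> h (u n) (v n) @[n --> \oo] --> h x y) ->
  sm f -> sm g -> sm (fun t => h (f t) (g t)).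
Proof.
move=> hc /sm_approx[s [ss sf _]] /sm_approx[r [sr rg _]].
apply: (sm_cvg (f := fun n t => h (s n t) (r n t))) => [n|t]; last exact: hc.
apply: sm_simple.
exact: (simple_comp (fun p => h p.1 p.2) (simple_pair (ss n) (sr n))).
Qed.

Lemma smD {E} (f g : T -> E) : sm f -> sm g -> sm (fun t => f t + g t).
Proof. by apply: sm_comp2 => u v x y; exact: cvgD. Qed.

Lemma sm_complex (a : T -> R) :
  measurable_fun setT a -> sm (fun t => (a t)%:C%C : R[i]^o).
Proof.
move=> ma; split.
  move=> [x y].
  rewrite (_ : (fun t => _) = (fun t => Num.sqrt ((a t - x) ^+ 2 + y ^+ 2))).
    have ms : measurable_fun setT (Num.sqrt : R -> R).
      by apply: continuous_measurable_fun; exact: sqrt_continuous.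
    apply: (measurableT_comp ms); apply: measurable_funD => //.
    by apply: measurable_funX; exact: measurable_funB.
  by apply/funext => t; rewrite /rnorm normc_def/= sub0r sqrrN.
(* Real rational points are enough, since [a] takes real values. *)
exists (fun n => (ratr (odflt 0 (unpickle n)))%:C%C) => t e e0.
have /rat_in_itvoo[q] : a t - e < a t + e by lra.
rewrite in_itv/= => /andP[q1 q2]; exists (pickle q); rewrite pickleK/=.
rewrite /rnorm normc_def/= subr0 expr0n addr0 sqrtr_sqr.
by rewrite ltr_norml; apply/andP; split; lra.
Qed.

Lemma sm_scale {E} (a : T -> R) (f : T -> E) :
  measurable_fun setT a -> sm f -> sm (fun t => (a t)%:C%C *: f t).
Proof.
move=> /sm_complex; apply: (sm_comp2 (h := fun (z : R[i]^o) x => z *: x)).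
by move=> u v x y; exact: cvgZ.
Qed.

(* The library's [f \_ A] takes the value [point] outside [A], which need not
   be zero in a normed module. *)
Definition restrict0 {E} (A : set T) (f : T -> E) (t : T) : E :=
  if t \in A then f t else 0.

Lemma sm_restrict0 {E} (A : set T) (f : T -> E) :
  measurable A -> sm f -> sm (restrict0 A f).
Proof.
move=> mA smf.
rewrite (_ : restrict0 A f = (fun t => (\1_A t)%:C%C *: f t)); first exact: sm_scale.
apply/funext => t; rewrite /restrict0 indicE.
by case: (t \in A); rewrite ?mulr1n ?mulr0n ?scale1r ?scale0r.
Qed.

Lemma strongly_measurableP {E} (mu : {measure set T -> \bar R}) (D : set T) (f : T -> E) :
  measurable D ->
  strongly_measurable mu D f <->
  exists2 g, sm g & {ae mu, forall t, D t -> f t = g t}.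
Proof.
move=> mD; split.
  move=> [s [ss [N [mN N0 sN]]]].
  exists (restrict0 (D `\` N) f); last first.
    exists N; split=> // t /= h; apply: contrapT => Nt; apply: h => Dt.
    by rewrite /restrict0 mem_set.
  apply: (sm_cvg (f := fun n => restrict0 (D `\` N) (s n))) => [n|t].
    by apply: sm_restrict0; [exact: measurableD|exact: sm_simple].
  rewrite /restrict0; case: ifPn => [|_]; last exact: cvg_cst.
  by rewrite inE => -[Dt Nt]; apply: contrapT => h; apply: Nt; apply: sN => /= /(_ Dt).
move=> [g /sm_approx[s [ss sg _]] fg]; exists s; split=> //.
by apply: filterS fg => t fg /fg ->.
Qed.

End StrongMeasurability.
Local Notation sm := separably_measurable.

(** * The Bochner integral *)

Section LowerIntegral.
Context {d : measure_display} {T : measurableType d} {R : realType}.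
Variables (mu : {measure set T -> \bar R}) (D : set T).
Hypothesis mD : measurable D.
Import HBNNSimple.

(* No measurability is assumed: the integral of a nonnegative function is a
   supremum over simple functions below it, and these may be set to zero on a
   null set. *)
Lemma ae_le_ge0_integral (f g : T -> \bar R) :
  (forall x, D x -> (0 <= f x)%E) -> (forall x, D x -> (0 <= g x)%E) ->
  {ae mu, forall x, D x -> (f x <= g x)%E} ->
  (\int[mu]_(x in D) f x <= \int[mu]_(x in D) g x)%E.
Proof.
move=> f0 g0 [N [mN N0 fgN]].
rewrite !ge0_integralE//; apply: ge_ereal_sup => _ [h /= hf <-].
pose h' : {nnsfun T >-> R} := mul_nnsfun h (indic_nnsfun R (measurableC mN)).
have h'E x : h' x = h x * \1_(~` N) x by [].
have -> : sintegral mu h = sintegral mu h'.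
  rewrite -!integralT_nnsfun; apply: ae_eq_integral => //.
  - exact/measurable_EFinP.
  - exact/measurable_EFinP.
  exists N; split => // x /= /not_implyP[_ hx].
  apply: contrapT => Nx; apply: hx.
  by rewrite /= [mindic _ _ _]indicE mem_set// mulr1.
apply: ereal_sup_ubound; exists h' => // x; rewrite h'E.
have [Nx|Nx] := pselect (N x).
  rewrite indicE memNset; last by move=> /(_ Nx).
  by rewrite mulr0 patchE; case: ifPn => // /set_mem /g0.
rewrite indicE mem_set// mulr1; apply: (le_trans (hf x)).
rewrite !patchE; case: ifPn => // /set_mem Dx.
by apply: contrapT => h2; apply: Nx; apply: fgN => /= /(_ Dx).
Qed.

Lemma ae_eq_ge0_integral (f g : T -> \bar R) :
  (forall x, D x -> (0 <= f x)%E) -> (forall x, D x -> (0 <= g x)%E) ->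
  {ae mu, forall x, D x -> f x = g x} ->
  (\int[mu]_(x in D) f x = \int[mu]_(x in D) g x)%E.
Proof.
move=> f0 g0 fg; apply/eqP; rewrite eq_le; apply/andP.
by split; apply: ae_le_ge0_integral => //; apply: filterS fg => x fg /fg ->.
Qed.

End LowerIntegral.

Section BochnerIntegral.
Context {d : measure_display} {T : measurableType d} {R : realType}.
Variables (mu : {measure set T -> \bar R}) (D : set T).
Hypothesis mD : measurable D.
Implicit Types (E F : normedModType R[i]).

Local Notation values s := (finmap.enum_fset (fset_set (range s))).

Let m (A : set T) := fine (mu (D `&` A)).

Lemma measurable_simple_fiber {E} (s : T -> E) (B : set E) :
  simple_function s -> measurable (D `&` s @^-1` B).
Proof. by move=> ss; apply: measurableI => //; exact: simple_preimage. Qed.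

Lemma mem_values {E} (s : T -> E) (y : E) :
  simple_function s -> (y \in values s) = (y \in range s).
Proof. by case=> fs _; exact: in_fset_set. Qed.

Lemma measure_simple_comp {E F} (q : T -> F) (g : F -> E) (y : E) :
  simple_function q ->
  (mu (D `&` (g \o q) @^-1` [set y]) =
   \sum_(z <- values q | g z == y) mu (D `&` q @^-1` [set z]))%E.
Proof.
move=> sq; have [fq _] := sq.
have -> : D `&` (g \o q) @^-1` [set y] =
    \bigcup_(z in range q `&` g @^-1` [set y]) (D `&` q @^-1` [set z]).
  apply/seteqP; split => [t [Dt gy]|t [z [_ gz] [Dt /= qz]]].
    by exists (q t) => //; split => //; exists t.
  by split => //=; rewrite qz.
rewrite measure_fin_bigcup; last 3 first.
- exact: finite_setIl.
- by move=> z z' _ _ [t [[_ <-] [_ <-]]].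
- by move=> z _; exact: measurable_simple_fiber.
rewrite fsbig_mkcondr fsbig_finite// [RHS]big_mkcond/=.
apply: eq_bigr => z _; case: eqP => gz; first by rewrite mem_set.
by rewrite memNset.
Qed.

(** Indexing by the values of [q] instead of those of [g \o q] brings several integrals over one
    index set: with [q] a pair of simple functions, linearity becomes termwise. *)
Lemma simple_integral_comp {E F} (q : T -> F) (g : F -> E) :
  simple_function q ->
  (forall z, g z != 0 -> (mu (D `&` q @^-1` [set z]) < +oo)%E) ->
  simple_integral mu D (g \o q) =
  \sum_(z <- values q) (m (q @^-1` [set z]))%:C%C *: g z.
Proof.
move=> sq fin; rewrite /simple_integral.
have sgq := simple_comp g sq; have [fq _] := sq; have [fgq _] := sgq.
rewrite fsbig_finite//.
transitivity (\sum_(y <- values (g \o q))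
    \sum_(z <- values q | g z == y) (m (q @^-1` [set z]))%:C%C *: g z).
  (* The fibre of 0 may have infinite measure, where [fine] is not additive; its contribution
     vanishes anyway. *)
  apply: eq_bigr => y _; have [->|y0] := eqVneq y 0.
    by rewrite scaler0 big1// => z /eqP ->; rewrite scaler0.
  rewrite measure_simple_comp// -sum_fine; last first.
    by move=> z /eqP gz; rewrite ge0_fin_numE// fin// gz.
  by rewrite rmorph_sum/= scaler_suml; apply: eq_bigr => z /eqP ->.
rewrite (exchange_big_dep xpredT)//=.
rewrite big_seq [RHS]big_seq; apply: eq_bigr => z; rewrite mem_values// => qz.
rewrite -big_filter (_ : [seq _ <- _ | _] = [:: g z]) ?big_seq1//.
have gzr : g z \in values (g \o q).
  by rewrite mem_values//; move: qz; rewrite !inE => -[t _ <-]; exists t.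
rewrite -(@filter_pred1_uniq _ _ _ (finmap.fset_uniq _) gzr).
by apply: eq_filter => y /=; rewrite eq_sym.
Qed.

Lemma integrable_simple_comp {E F} (q : T -> F) (g : F -> E) :
  simple_function q ->
  (forall z, g z != 0 -> (mu (D `&` q @^-1` [set z]) < +oo)%E) ->
  integrable_simple mu D (g \o q).
Proof.
move=> sq fin; split; first exact: simple_comp.
move=> y y0; rewrite measure_simple_comp//; apply: lte_sum_pinfty => z /eqP gz.
by rewrite fin// gz.
Qed.

Lemma integrable_simple_pair {E F} (s : T -> E) (r : T -> F) (z : E * F) :
  integrable_simple mu D s -> integrable_simple mu D r -> z != 0 ->
  (mu (D `&` (fun t => (s t, r t)) @^-1` [set z]) < +oo)%E.
Proof.
move=> [ss fs] [sr fr]; case: z => x y xy0.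
have mp := measurable_simple_fiber [set (x, y)] (simple_pair ss sr).
have [x0|x0] := eqVneq x 0; last first.
  apply: le_lt_trans (fs _ x0); apply: le_measure; rewrite ?inE//.
    exact: measurable_simple_fiber.
  by move=> t [Dt [<- _]].
have y0 : y != 0 by apply: contra_neq xy0 => y0; rewrite x0 y0.
apply: le_lt_trans (fr _ y0); apply: le_measure; rewrite ?inE//.
  exact: measurable_simple_fiber.
by move=> t [Dt [_ <-]].
Qed.

Section SimpleLinear.
Context {E : normedModType R[i]}.
Variables (a : R) (s r : T -> E).
Hypotheses (is_s : integrable_simple mu D s) (is_r : integrable_simple mu D r).

Let q t : E * E := (s t, r t).

Let sq : simple_function q.
Proof. by apply: simple_pair; [case: is_s|case: is_r]. Qed.

Let fin (g : E * E -> E) z : g 0 = 0 -> g z != 0 ->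
  (mu (D `&` q @^-1` [set z]) < +oo)%E.
Proof.
move=> g0 gz; apply: integrable_simple_pair => //.
by apply: contra_neq gz => ->.
Qed.

Lemma integrable_simpleD :
  integrable_simple mu D (fun t => s t + a%:C%C *: r t).
Proof.
apply: (integrable_simple_comp (g := fun z => z.1 + a%:C%C *: z.2) sq).
by move=> z; apply: (fin (g := fun z => z.1 + a%:C%C *: z.2)); rewrite /= scaler0 addr0.
Qed.

Lemma simple_integralD :
  simple_integral mu D (fun t => s t + a%:C%C *: r t) =
  simple_integral mu D s + a%:C%C *: simple_integral mu D r.
Proof.
rewrite (simple_integral_comp (g := fun z => z.1 + a%:C%C *: z.2) sq); last first.
  by move=> z; apply: (fin (g := fun z => z.1 + a%:C%C *: z.2)); rewrite /= scaler0 addr0.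
rewrite (_ : s = fst \o q)// (_ : r = snd \o q)//.
rewrite !(simple_integral_comp (q := q))//; try by move=> z; exact: fin.
rewrite scaler_sumr -big_split/=; apply: eq_bigr => z _.
by rewrite scalerDr !scalerA mulrC.
Qed.

End SimpleLinear.

Lemma integral_rnorm_simple {E} (s : T -> E) : integrable_simple mu D s ->
  (\int[mu]_(t in D) (rnorm (s t))%:E =
   (\sum_(y <- values s) m (s @^-1` [set y]) * rnorm y)%:E)%E.
Proof.
move=> [ss fs]; have [rs ms] := ss.
transitivity (\int[mu]_(t in D) (\sum_(y <- values s)
    (rnorm y)%:E * (\1_(s @^-1` [set y]) t)%:E))%E.
  apply: eq_integral => t _; rewrite (bigD1_seq (s t))/=; last exact: finmap.fset_uniq.
    by rewrite indicE mem_set// mule1 big1 ?adde0// => y yt;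
      rewrite indicE memNset ?mule0// /preimage/= => h; rewrite h eqxx in yt.
  by rewrite mem_values// inE; exists t.
rewrite ge0_integral_sum//; last 2 first.
- by move=> y; apply: measurable_funeM; apply/measurable_EFinP; exact: measurable_indic.
- by move=> y t _; rewrite mule_ge0 ?lee_fin ?rnorm_ge0.
rewrite -sumEFin; apply: eq_bigr => y _.
rewrite ge0_integralZl_EFin ?rnorm_ge0//; last first.
  by apply/measurable_EFinP; exact: measurable_indic.
rewrite integral_indic// setIC EFinM muleC.
have [->|y0] := eqVneq y 0; first by rewrite rnorm0 !mule0.
by rewrite /m fineK// ge0_fin_numE// fs.
Qed.

Lemma rnorm_sum {E} (I : Type) (l : seq I) (f : I -> E) :
  rnorm (\sum_(i <- l) f i) <= \sum_(i <- l) rnorm (f i).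
Proof.
elim: l => [|i l IH]; first by rewrite !big_nil rnorm0.
by rewrite !big_cons; apply: (le_trans (rnormD _ _)); rewrite lerD2l.
Qed.

Lemma rnorm_simple_integral {E} (s : T -> E) : integrable_simple mu D s ->
  ((rnorm (simple_integral mu D s))%:E <= \int[mu]_(t in D) (rnorm (s t))%:E)%E.
Proof.
move=> is_s; rewrite integral_rnorm_simple// lee_fin.
case: is_s => -[fs _] _; rewrite /simple_integral fsbig_finite//.
apply: (le_trans (rnorm_sum _ _)); apply: ler_sum => y _.
by rewrite rnormZ ger0_norm// fine_ge0.
Qed.

End BochnerIntegral.

Lemma cvge0P {R : realType} (u : nat -> \bar R) : (forall n, (0 <= u n)%E) ->
  u n @[n --> \oo] --> 0%E <->
  forall e : R, 0 < e -> exists N, forall n, (N <= n)%N -> (u n < e%:E)%E.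
Proof.
move=> u0; split.
  move=> /fine_cvgP[[N _ uN] /cvgrPdist_lt h] e /h[N' _ uN'].
  exists (maxn N N') => n; rewrite geq_max => /andP[Nn N'n].
  have := uN' _ N'n; rewrite /= sub0r normrN ger0_norm ?fine_ge0//.
  by rewrite -lte_fin fineK//; exact: uN.
move=> h; apply/fine_cvgP; split.
  have [N hN] := h _ ltr01; exists N => // n /= /hN un.
  by rewrite ge0_fin_numE// (lt_trans un) ?ltry.
apply/cvgrPdist_lt => e e0; have [N hN] := h _ e0.
exists N => // n /= /hN un; rewrite sub0r normrN ger0_norm ?fine_ge0//.
by rewrite -lte_fin fineK// ge0_fin_numE// (lt_trans un) ?ltry.
Qed.

Section BochnerTheory.
Context {d : measure_display} {T : measurableType d} {R : realType}.
Variables (mu : {measure set T -> \bar R}).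
Implicit Types (E F : normedModType R[i]) (D : set T).

Lemma rnormE_ge0 {E} (f : T -> E) t : (0 <= (rnorm (f t))%:E)%E.
Proof. by rewrite lee_fin rnorm_ge0. Qed.

Lemma integral_rnorm_ge0 {E} D (f : T -> E) :
  (0 <= \int[mu]_(t in D) (rnorm (f t))%:E)%E.
Proof. by apply: integral_ge0 => t _; exact: rnormE_ge0. Qed.

Lemma sm_rnormE {E} (f : T -> E) D :
  sm f -> measurable_fun D (fun t => (rnorm (f t))%:E).
Proof.
by move=> sf; apply/measurable_EFinP; apply: measurable_funTS; exact: sm_rnorm.
Qed.

Lemma smB {E} (f g : T -> E) : sm f -> sm g -> sm (fun t => f t - g t).
Proof.
by apply: (sm_comp2 (h := fun x y => x - y)) => u v x y; exact: cvgB.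
Qed.

Lemma bochner_ae_eq {E} D (f g : T -> E) v : measurable D ->
  {ae mu, forall t, D t -> f t = g t} ->
  is_bochner_integral mu D f v -> is_bochner_integral mu D g v.
Proof.
move=> mD fg [/(strongly_measurableP mu _ mD)[h smh fh] [s [is_s s0 sv]]]; split.
  apply/strongly_measurableP => //; exists h => //.
  by apply: filterS2 fg fh => t fg fh Dt; rewrite -fg// fh.
exists s; split => //.
suff E' n : (\int[mu]_(x in D) (rnorm (g x - s n x))%:E =
    \int[mu]_(x in D) (rnorm (f x - s n x))%:E)%E.
  by under eq_fun do rewrite E'.
apply: ae_eq_ge0_integral => //; try by move=> x _; exact: (rnormE_ge0 (fun x => _)).
by apply: filterS fg => t fg /fg ->.
Qed.

(** Linearity of the scalar integral needs genuinely measurable norms, which a strongly measurable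
    function has only up to a null set; the representative [g] supplies them. *)
Lemma bochner_sm {E} D (f : T -> E) v : measurable D ->
  is_bochner_integral mu D f v ->
  exists g, [/\ sm g, {ae mu, forall t, D t -> f t = g t} &
    is_bochner_integral mu D g v].
Proof.
move=> mD bf; have [/(strongly_measurableP mu _ mD)[g sg fg] _] := bf.
by exists g; split => //; exact: bochner_ae_eq bf.
Qed.

Lemma ge0_integral_le_add {E F} D (f g : T -> E) (h : T -> F) (a : R) :
  measurable D -> sm f -> sm g -> sm h -> 0 <= a ->
  (forall t, D t -> rnorm (h t) <= rnorm (f t) + a * rnorm (g t)) ->
  (\int[mu]_(t in D) (rnorm (h t))%:E <=
   \int[mu]_(t in D) (rnorm (f t))%:E + a%:E * \int[mu]_(t in D) (rnorm (g t))%:E)%E.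
Proof.
move=> mD sf sg sh a0 hle.
rewrite -ge0_integralZl_EFin//; last 2 first.
- by move=> t _; exact: rnormE_ge0.
- exact: sm_rnormE.
rewrite -ge0_integralD//; last 4 first.
- by move=> t _; exact: rnormE_ge0.
- exact: sm_rnormE.
- by move=> t _; rewrite mule_ge0 ?lee_fin ?rnorm_ge0.
- by apply: measurable_funeM; exact: sm_rnormE.
apply: ge0_le_integral => //.
- by move=> t _; exact: rnormE_ge0.
- exact: sm_rnormE.
- by apply: emeasurable_funD; [|apply: measurable_funeM]; exact: sm_rnormE.
Qed.

Lemma bochner_norm {E} D (f : T -> E) v : measurable D ->
  is_bochner_integral mu D f v ->
  ((rnorm v)%:E <= \int[mu]_(t in D) (rnorm (f t))%:E)%E.
Proof.
move=> mD /(bochner_sm mD)[g [sg fg [_ [s [is_s s0 sv]]]]].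
have -> : (\int[mu]_(t in D) (rnorm (f t))%:E =
    \int[mu]_(t in D) (rnorm (g t))%:E)%E.
  apply: ae_eq_ge0_integral => //; try by move=> x _; exact: rnormE_ge0.
  by apply: filterS fg => t fg /fg ->.
apply/lee_addgt0Pr => e e0; have e20 : 0 < e / 2 by rewrite divr_gt0.
move/cvge0P : s0 => /(_ (fun n => integral_rnorm_ge0 _ _) _ e20).
move=> [N hN].
have /cvg_rnormP/cvgrPdist_lt/(_ _ e20)[N' _ hN'] := sv.
have {}hN := hN _ (leq_maxl N N'); have {hN'}/= := hN' _ (leq_maxr N N').
set n := maxn N N' in hN *; rewrite sub0r normrN ger0_norm ?rnorm_ge0// => hS.
have h1 := rnorm_simple_integral mD (is_s n).
have ssn : sm (s n) by apply: sm_simple; case: (is_s n).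
have h2 : (\int[mu]_(t in D) (rnorm (s n t))%:E <=
   \int[mu]_(t in D) (rnorm (g t))%:E +
   1%:E * \int[mu]_(t in D) (rnorm (g t - s n t))%:E)%E.
  apply: ge0_integral_le_add => //; first exact: smB.
  move=> t _; rewrite mul1r -[X in rnorm X <= _](subrK (g t)) addrC.
  by apply: le_trans (rnormD _ _) _; rewrite rnormB.
rewrite mul1e in h2.
have h3 : ((rnorm v)%:E <= (rnorm (simple_integral mu D (s n)))%:E + (e / 2)%:E)%E.
  rewrite -EFinD lee_fin addrC; apply: (le_trans (rnorm_le_dist _ (simple_integral mu D (s n)))).
  by rewrite lerD2r rnormB ltW.
apply: (le_trans h3); rewrite [X in (_ <= _ + X%:E)%E](splitr e) EFinD addeA leeD2r//.
by apply: (le_trans (le_trans h1 h2)); rewrite leeD2l// ltW.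
Qed.

Lemma bochnerD {E} D (f g : T -> E) v w (a : R) : measurable D ->
  is_bochner_integral mu D f v -> is_bochner_integral mu D g w ->
  is_bochner_integral mu D (fun t => f t + a%:C%C *: g t) (v + a%:C%C *: w).
Proof.
move=> mD /(bochner_sm mD)[f' [sf ff [_ [s [is_s s0 sv]]]]].
move=> /(bochner_sm mD)[g' [sg gg [_ [r [is_r r0 rw]]]]].
have sZ (h : T -> E) : sm h -> sm (fun t => a%:C%C *: h t).
  by move=> smh; apply: (@sm_scale _ _ _ _ (cst a)).
apply: (bochner_ae_eq (f := fun t => f' t + a%:C%C *: g' t)) => //.
  by apply: filterS2 ff gg => t ff gg Dt; rewrite ff// gg.
split.
  apply/strongly_measurableP => //; exists (fun t => f' t + a%:C%C *: g' t).
    by apply: smD => //; exact: sZ.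
  exact: aeW.
have ss n : sm (s n) by apply: sm_simple; case: (is_s n).
have sr n : sm (r n) by apply: sm_simple; case: (is_r n).
exists (fun n t => s n t + a%:C%C *: r n t); split.
- by move=> n; exact: integrable_simpleD.
- have r0' := cvgeZl (y := `|a|%:E) isT r0; rewrite mule0 in r0'.
  have lim0 : (\int[mu]_(x in D) (rnorm (f' x - s n x))%:E +
      `|a|%:E * \int[mu]_(x in D) (rnorm (g' x - r n x))%:E)%E @[n --> \oo] --> 0%E.
    by rewrite -[X in _ --> X]adde0; apply: cvgeD.
  refine (squeeze_cvge (f := cst 0%E) _ (cvg_cst _) lim0).
  near=> n; rewrite integral_rnorm_ge0/=.
  apply: (ge0_integral_le_add (f := fun t => f' t - s n t) (g := fun t => g' t - r n t)) => //.
  + exact: smB.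
  + exact: smB.
  + by apply: smB; apply: smD => //; exact: sZ.
  + move=> t _; rewrite -rnormZ opprD addrACA -scalerBr; exact: rnormD.
- under eq_fun do rewrite simple_integralD//.
  by apply: cvgD => //; apply: cvg_scale_real => //; exact: cvg_cst.
Unshelve. all: by end_near.
Qed.

(** The approximants of [sm_approx] converge in mean by dominated convergence. Their integrals are
    then Cauchy, because the integral of a simple function is bounded by that of its norm, and
    completeness gives the value. *)
Lemma bochner_exists {E : completeNormedModType R[i]} D (f : T -> E) :
  measurable D -> strongly_measurable mu D f ->
  (\int[mu]_(t in D) (rnorm (f t))%:E < +oo)%E ->
  exists v : E, is_bochner_integral mu D f v.
Proof.
move=> mD /(strongly_measurableP mu _ mD)[g sg fg].
have -> : (\int[mu]_(t in D) (rnorm (f t))%:E =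
    \int[mu]_(t in D) (rnorm (g t))%:E)%E.
  apply: ae_eq_ge0_integral => //; try by move=> x _; exact: rnormE_ge0.
  by apply: filterS fg => t fg /fg ->.
move=> ig; suff [v bv] : exists v : E, is_bochner_integral mu D g v.
  by exists v; apply: bochner_ae_eq bv => //; apply: filterS fg => t fg /fg ->.
have [s [ss sg_ sle]] := sm_approx sg.
have smss n := sm_simple (ss n).
have ifg : mu.-integrable D (fun t => (rnorm (g t))%:E).
  apply/integrableP; split; first exact: sm_rnormE.
  by under eq_integral do rewrite gee0_abs ?lee_fin ?rnorm_ge0//.
have s0 : (\int[mu]_(x in D) (rnorm (g x - s n x))%:E)%E @[n --> \oo] --> 0%E.
  rewrite -(integral0 mu D).
  apply: (@dominated_cvg _ _ _ mu D mD _ _ (fun t => (rnorm (g t))%:E)) => //.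
  - by move=> n; apply: sm_rnormE; exact: smB.
  - move=> x _; apply: cvg_EFin; first exact: nearW.
    rewrite /comp/=; under eq_fun do rewrite rnormB.
    by apply/cvg_rnormP.
  - by move=> n x _; rewrite gee0_abs ?lee_fin ?rnorm_ge0.
(* Chebyshev's inequality: [rnorm y] times the measure of the fibre of [y] is at most the integral
   of the norm of [s n], which is at most twice that of [g]. *)
have is_s n : integrable_simple mu D (s n).
  split=> // y y0; have yp : 0 < rnorm y.
    by rewrite lt_neqAle rnorm_ge0 eq_sym rnorm_eq0 y0.
  have sfin : (\int[mu]_(t in D) (rnorm (s n t))%:E < +oo)%E.
    apply: (@le_lt_trans _ _ (\int[mu]_(t in D) (rnorm (g t))%:E +
        1%:E * \int[mu]_(t in D) (rnorm (g t))%:E)%E).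
      apply: ge0_integral_le_add => // t _.
      rewrite mul1r -[X in rnorm X <= _](subrK (g t)).
      by apply: le_trans (rnormD _ _) _; rewrite rnormB lerD2r.
    by rewrite mul1e lte_add_pinfty.
  have mDy := measurable_simple_fiber mD [set y] (ss n).
  have : ((rnorm y)%:E * mu (D `&` s n @^-1` [set y]) < +oo)%E.
    apply: le_lt_trans sfin; rewrite setIC -integral_indic//; last by case: (ss n).
    rewrite -ge0_integralZl_EFin ?rnorm_ge0//; last first.
      by apply/measurable_EFinP; apply: measurable_indic; case: (ss n).
    apply: ge0_le_integral => //.
    - by move=> t _; rewrite mule_ge0 ?lee_fin ?rnorm_ge0.
    - apply: measurable_funeM; apply/measurable_EFinP; apply: measurable_indic.
      by case: (ss n).
    - exact: sm_rnormE.
    move=> t _; rewrite indicE; case: (boolP (t \in _)) => [/set_mem <-|_].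
      by rewrite mule1.
    by rewrite mule0 lee_fin rnorm_ge0.
  by rewrite !ltey; apply: contra_neq => ->; rewrite gt0_muley ?lte_fin.
have [v sv] : exists v : E, simple_integral mu D (s n) @[n --> \oo] --> v.
  apply: rnorm_cauchy_cvg => e e0; have e20 : 0 < e / 2 by rewrite divr_gt0.
  move/cvge0P : s0 => /(_ (fun n => integral_rnorm_ge0 _ _) _ e20).
  move=> [N hN]; exists N => m n Nm Nn.
  have := rnorm_simple_integral mD (integrable_simpleD mD (-1) (is_s m) (is_s n)).
  rewrite simple_integralD// rmorphN1 scaleN1r => h.
  rewrite -lte_fin; apply: (le_lt_trans h).
  under eq_integral do rewrite scaleN1r.
  apply: (@le_lt_trans _ _ (\int[mu]_(x in D) (rnorm (g x - s m x))%:E +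
      1%:E * \int[mu]_(x in D) (rnorm (g x - s n x))%:E)%E).
    apply: (ge0_integral_le_add (f := fun x => g x - s m x)
      (g := fun x => g x - s n x)) => //; try exact: smB.
    by move=> t _; rewrite mul1r (rnormB (g t) (s m t)); exact: rnorm_triangle.
  by rewrite mul1e (splitr e) EFinD lteD// hN.
exists v; split; last by exists s.
by apply/strongly_measurableP => //; exists g => //; exact: aeW.
Qed.

Lemma simple_integral_restrict0 {E} D D' (s : T -> E) : D' `<=` D ->
  simple_integral mu D (restrict0 D' s) = simple_integral mu D' s.
Proof.
move=> D'D; rewrite /simple_integral.
(* The two functions have different ranges. Both sums extend to all of [E], since a point outside
   the range has an empty fibre. *)
rewrite (fsbig_widen (range (restrict0 D' s)) setT)//=; last first.
  by move=> y [_ ny]; rewrite /= preimage10// setI0 measure0 scale0r.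
rewrite [RHS](fsbig_widen _ setT)//=; last first.
  by move=> y [_ ny]; rewrite /= preimage10// setI0 measure0 scale0r.
apply: eq_fsbigr => y _; have [->|y0] := eqVneq y 0; first by rewrite !scaler0.
congr ((fine (mu _))%:C%C *: _); apply/seteqP; rewrite /restrict0; split=> t /=.
  by case: ifPn => [/set_mem D't [] //|_ [_ h]]; rewrite h eqxx in y0.
by move=> [D't sy]; rewrite mem_set//; split => //; exact: D'D.
Qed.

Lemma integral_restrict0 {E} D D' (f : T -> E) : D' `<=` D ->
  (\int[mu]_(t in D) (rnorm (restrict0 D' f t))%:E =
   \int[mu]_(t in D') (rnorm (f t))%:E)%E.
Proof.
move=> D'D; rewrite -[in RHS](setIidr D'D) integral_mkcondr.
apply: eq_integral => t _; rewrite patchE /restrict0.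
by case: ifPn => // _; rewrite rnorm0.
Qed.

Lemma strongly_measurable_restrict0 {E} D D' (f : T -> E) :
  measurable D -> measurable D' ->
  strongly_measurable mu D' f -> strongly_measurable mu D (restrict0 D' f).
Proof.
move=> mD mD' /(strongly_measurableP mu _ mD')[g sg fg].
apply/strongly_measurableP => //; exists (restrict0 D' g); first exact: sm_restrict0.
apply: filterS fg => t fg _; rewrite /restrict0.
by case: ifPn => // /set_mem /fg.
Qed.

Lemma bochner_restrict0 {E} D D' (f : T -> E) v :
  measurable D -> measurable D' -> D' `<=` D ->
  is_bochner_integral mu D' f v -> is_bochner_integral mu D (restrict0 D' f) v.
Proof.
move=> mD mD' D'D [smf [s [is_s s0 sv]]].
split; first exact: strongly_measurable_restrict0.
exists (fun n => restrict0 D' (s n)); split.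
- move=> n; have [ss fs] := is_s n; split; first by apply: simple_if => //; exact: simple_cst.
  move=> y y0; apply: le_lt_trans (fs _ y0); apply: le_measure; rewrite ?inE//.
  + by apply: measurable_simple_fiber => //; apply: simple_if => //; exact: simple_cst.
  + exact: measurable_simple_fiber.
  move=> t [Dt]; rewrite /restrict0/=.
  by case: ifPn => [/set_mem D't //|_ h]; rewrite h eqxx in y0.
- have E' n : (\int[mu]_(x in D) (rnorm (restrict0 D' f x - restrict0 D' (s n) x))%:E =
      \int[mu]_(x in D') (rnorm (f x - s n x))%:E)%E.
    rewrite -(integral_restrict0 _ D'D); apply: eq_integral => t _.
    by rewrite /restrict0; case: ifPn; rewrite ?subr0.
  by under eq_fun do rewrite E'.
- by under eq_fun do rewrite simple_integral_restrict0//.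
Qed.

(** The integral over [D'] is also the integral over [D] of [f] cut off to [D']. The difference of
    the two integrands over [D] is [f] on the complement of [D'] and 0 elsewhere, so the norm bound
    applies. *)
Lemma bochner_subset {E} D D' (f : T -> E) v v' :
  measurable D -> measurable D' -> D' `<=` D ->
  is_bochner_integral mu D f v -> is_bochner_integral mu D' f v' ->
  ((rnorm (v - v'))%:E <= \int[mu]_(t in D `\` D') (rnorm (f t))%:E)%E.
Proof.
move=> mD mD' D'D fv /(bochner_restrict0 mD mD' D'D) fv'.
have := bochner_norm mD (bochnerD (-1) mD fv fv').
rewrite rmorphN1 scaleN1r -(integral_restrict0 _ (@subDsetl _ D D')).
congr (_ <= _)%E; apply: eq_integral => t /set_mem Dt.
rewrite scaleN1r /restrict0.
have [D't|D't] := pselect (D' t).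
  by rewrite mem_set// subrr memNset// => -[].
by rewrite memNset// subr0 mem_set.
Qed.

End BochnerTheory.

(** * Hardy's inequality *)

Section PowerIntegrals.
Context {R : realType}.
Local Notation leb := (@lebesgue_measure R).
Implicit Types (a b m t : R).

Lemma powR_gt0D t a b : 0 < t -> t `^ (a + b) = t `^ a * t `^ b.
Proof. by move=> t0; rewrite powRD// (gt_eqF t0) implybT. Qed.

Lemma continuous_powR m t : 0 < t -> {for t, continuous (@powR R ^~ m)}.
Proof.
move=> t0; apply/differentiable_continuous/derivable1_diffP.
by have [] := is_derive1_powR m t0.
Qed.

Lemma measurable_powR_mul m D : measurable_fun D (fun t => t `^ m).
Proof. exact: measurable_funTS (measurable_powR m). Qed.

Lemma integral_powR_itv m a b : 0 < a -> a < b -> m + 1 != 0 ->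
  (\int[leb]_(t in `[a, b]) (t `^ m)%:E =
   ((b `^ (m + 1) - a `^ (m + 1)) / (m + 1))%:E)%E.
Proof.
move=> a0 ab m1.
have dF t : 0 < t -> is_derive t 1 (fun t => t `^ (m + 1) / (m + 1)) (t `^ m).
  move=> t0; have := is_derive1_powR (m + 1) t0; rewrite addrK => h.
  have {h} := is_deriveM h (is_derive_cst (m + 1)^-1 t 1).
  rewrite scaler0 add0r /GRing.scale/= mulrA mulVf// mul1r.
  by [].
have pos t : t \in `[a, b] -> 0 < t.
  by rewrite in_itv/= => /andP[at_ _]; exact: lt_le_trans at_.
have cF t : 0 < t -> {for t, continuous (fun t => t `^ (m + 1) / (m + 1))}.
  move=> t0; apply/differentiable_continuous/derivable1_diffP.
  by have [] := dF t t0.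
rewrite (@continuous_FTC2 _ _ (fun t => t `^ (m + 1) / (m + 1)))//.
- by rewrite -EFinB -mulrBl.
- apply: continuous_in_subspaceT => t /set_mem /= tab.
  by apply: continuous_powR; exact: pos.
- split.
  + move=> t tab; have [] // := dF t (pos t _).
    exact: subset_itv_oo_cc tab.
  + by apply: cvg_at_right_filter; exact: cF.
  + by apply: cvg_at_left_filter; apply: cF; exact: lt_trans ab.
- move=> t tab; have := dF t (pos t (subset_itv_oo_cc tab)).
  by move=> h; rewrite derive1E derive_val.
Qed.

Lemma ge0_integral_bigcup_le (F : nat -> set R) (f : R -> \bar R) (c : \bar R) :
  nondecreasing_seq F -> (forall n, measurable (F n)) ->
  measurable_fun setT f -> (forall t, (0 <= f t)%E) ->
  (forall n, (\int[leb]_(t in F n) f t <= c)%E) ->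
  (\int[leb]_(t in \bigcup_n F n) f t <= c)%E.
Proof.
move=> ndF mF mf f0 Fc.
have h : (\int[leb]_(t in F n) f t)%E @[n --> \oo] -->
    (\int[leb]_(t in \bigcup_n F n) f t)%E.
  apply: ge0_nondecreasing_set_cvg_integral => // n.
  exact: measurable_funTS.
rewrite -(cvg_lim _ h)//; apply: lime_le; last exact: nearW.
by apply/cvg_ex; eexists; exact: h.
Qed.

Lemma integral_powR_0 m t : 0 < t -> 0 < m + 1 ->
  (\int[leb]_(s in `]0%R, t[) (s `^ m)%:E <= (t `^ (m + 1) / (m + 1))%:E)%E.
Proof.
move=> t0 m0.
(* The exponent may be negative, so the fundamental theorem is applied away from 0. The shift [n.+2]
   keeps the left end strictly below [t]. *)
have -> : `]0, t[%classic = \bigcup_n `[t / n.+2%:R, t[%classic.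
  apply/seteqP; split => s /=.
    rewrite in_itv/= => /andP[s0 st].
    exists (Num.truncn (t / s)) => //=; rewrite in_itv/= st andbT.
    rewrite ler_pdivrMr// mulrC -ler_pdivrMr//.
    apply/ltW/(lt_le_trans (truncnS_gt _)).
    by rewrite ler_nat.
  move=> [n _]; rewrite /= !in_itv/= => /andP[h ->]; rewrite andbT.
  by apply: lt_le_trans h; rewrite divr_gt0.
apply: ge0_integral_bigcup_le => //.
- move=> i j ij; apply/subsetPset => s /=; rewrite !in_itv/= => /andP[h ->].
  rewrite andbT; apply: le_trans h.
  by rewrite ler_pM2l// lef_pV2 ?posrE// ler_nat.
- by apply/measurable_EFinP; exact: measurable_powR.
- by move=> s; rewrite lee_fin powR_ge0.
move=> n; have tn : 0 < t / n.+2%:R by rewrite divr_gt0.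
apply: (@le_trans _ _ (\int[leb]_(s in `[(t / n.+2%:R)%R, t]) (s `^ m)%:E)%E).
  apply: ge0_subset_integral => //.
  - by apply/measurable_EFinP; exact: measurable_powR_mul.
  - by move=> s _; rewrite lee_fin powR_ge0.
  - exact: subset_itv_co_cc.
rewrite integral_powR_itv//; last by rewrite gt_eqF.
  by rewrite lee_fin ler_pM2r ?invr_gt0// lerBlDr lerDl powR_ge0.
by rewrite ltr_pdivrMr// ltr_pMr// ltr1n.
Qed.

Lemma integral_powR_y m t : 0 < t -> m + 1 < 0 ->
  (\int[leb]_(s in `]t, +oo[) (s `^ m)%:E <= (t `^ (m + 1) / - (m + 1))%:E)%E.
Proof.
move=> t0 m0.
have -> : `]t, +oo[%classic = \bigcup_n `]t, t + n.+1%:R]%classic.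
  apply/seteqP; split => s /=.
    rewrite in_itv/= andbT => ts.
    exists (Num.truncn (s - t)) => //=; rewrite in_itv/= ts/=.
    by rewrite -lerBlDl ltW// truncnS_gt.
  by move=> [n _]; rewrite /= !in_itv/= => /andP[-> _].
apply: ge0_integral_bigcup_le => //.
- move=> i j ij; apply/subsetPset => s /=; rewrite !in_itv/= => /andP[-> h] /=.
  by apply: le_trans h _; rewrite lerD2l ler_nat.
- by apply/measurable_EFinP; exact: measurable_powR.
- by move=> s; rewrite lee_fin powR_ge0.
move=> n.
apply: (@le_trans _ _ (\int[leb]_(s in `[t, (t + n.+1%:R)%R]) (s `^ m)%:E)%E).
  apply: ge0_subset_integral => //.
  - by apply/measurable_EFinP; exact: measurable_powR_mul.
  - by move=> s _; rewrite lee_fin powR_ge0.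
  - exact: subset_itv_oc_cc.
rewrite integral_powR_itv//; last by rewrite lt_eqF.
  rewrite lee_fin -mulrNN -invrN ler_pM2r ?invr_gt0 ?oppr_gt0//.
  by rewrite opprB lerBlDr lerDl powR_ge0.
by rewrite ltrDl.
Qed.

End PowerIntegrals.

Section Hardy.
Context {R : realType}.
Local Notation leb := (@lebesgue_measure R).
Implicit Types (a c d p q r t : R) (G : R -> R).

Lemma le_poweR (x y : \bar R) p : 0 <= p -> (0 <= x)%E -> (x <= y)%E ->
  (x `^ p <= y `^ p)%E.
Proof.
move=> p0 x0 xy; apply: gt0_ler_poweR => //.
- by rewrite in_itv/= x0 leey.
- by rewrite in_itv/= (le_trans x0 xy) leey.
Qed.

(** Hölder's inequality for the product of [s^(d - c) G] and [s^c]; the condition [0 < c * q + 1]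
    puts the second factor in [L^q(0, t)]. Raising to the power [p] keeps the integral of [G^p] free
    of roots. *)
Lemma hoelder_powR G c d p q t :
  measurable_fun setT G -> (forall s, 0 <= G s) ->
  0 < p -> 0 < q -> p^-1 + q^-1 = 1 -> 0 < t -> 0 < c * q + 1 ->
  ((\int[leb]_(s in `]0%R, t[) (s `^ d * G s)%:E) `^ p <=
   (((t `^ (c * q + 1) / (c * q + 1)) `^ (p / q))%:E *
    \int[leb]_(s in `]0%R, t[) (s `^ ((d - c) * p) * G s `^ p)%:E))%E.
Proof.
move=> mG G0 p0 q0 pq t0 c0.
(* Both factors carry the indicator, so that Hölder's inequality on the whole line becomes one on
   [(0, t)]. *)
pose I := \1_(`]0%R, t[%classic : set R) : R -> R.
pose f s := I s * (s `^ (d - c) * G s).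
pose g s := I s * s `^ c.
have mI : measurable_fun setT I by exact: measurable_indic.
have mf : measurable_fun setT f.
  by apply: measurable_funM => //; exact: measurable_funM.
have mg : measurable_fun setT g.
  exact: measurable_funM.
have f0 s : 0 <= f s by rewrite /f /I indicE !mulr_ge0 ?powR_ge0.
have g0 s : 0 <= g s by rewrite /g /I indicE !mulr_ge0 ?powR_ge0.
have inI (F : R -> R) : (\int[leb]_(s in `]0%R, t[) (F s)%:E =
    \int[leb]_s (I s * F s)%:E)%E.
  rewrite integral_mkcond; apply: eq_integral => s _; rewrite patchE /I indicE.
  by case: ifPn => _; rewrite ?mul1r ?mul0r.
have := hoelder leb mf mg p0 q0 pq; rewrite Lnorm1.
have -> : (\int[leb]_x `|(EFin \o (f \* g)%R) x| =
    \int[leb]_(s in `]0%R, t[) (s `^ d * G s)%:E)%E.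
  rewrite inI; apply: eq_integral => s _ /=.
  rewrite ger0_norm; last exact: mulr_ge0.
  rewrite /f /g /I indicE.
  case: (boolP (s \in _)) => [/set_mem/=|_]; last by rewrite !mul0r.
  rewrite in_itv/= !mul1r => /andP[s0 _].
  by rewrite mulrAC -powR_gt0D// subrK.
move=> h; apply: (le_trans (le_poweR (ltW p0) _ h)).
  by apply: integral_ge0 => s _; rewrite lee_fin mulr_ge0 ?powR_ge0.
rewrite poweRM ?Lnorm_ge0// poweR_Lnorm ?gt_eqF// muleC.
have -> : (\int[leb]_x `|(EFin \o f) x| `^ p =
    \int[leb]_(s in `]0%R, t[) (s `^ ((d - c) * p) * G s `^ p)%:E)%E.
  rewrite inI; apply: eq_integral => s _ /=.
  rewrite ger0_norm// /f /I indicE.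
  case: (boolP (s \in _)) => [_|_]; last by rewrite !mul0r powR0// gt_eqF.
  by rewrite !mul1r powRM ?powR_ge0// -powRrM.
apply: lee_pmul => //.
- exact: poweR_ge0.
- by apply: integral_ge0 => s _; rewrite lee_fin mulr_ge0 ?powR_ge0.
rewrite -poweR_EFin [in leLHS](_ : p = q * (p / q)); last first.
  by rewrite mulrC divfK// gt_eqF.
rewrite poweRrM poweR_Lnorm ?gt_eqF//; apply: le_poweR.
- by rewrite divr_ge0 ?ltW.
- by apply: integral_ge0 => s _; exact: poweR_ge0.
apply: le_trans (integral_powR_0 t0 c0); rewrite inI.
rewrite le_eqVlt; apply/orP; left; apply/eqP; apply: eq_integral => s _ /=.
rewrite ger0_norm// /g /I indicE.
case: (boolP (s \in _)) => [_|_]; last by rewrite !mul0r powR0// gt_eqF.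
by rewrite !mul1r -powRrM.
Qed.

(** With this indicator at the point [(t, s)], the domain [0 < s < t] of the inner integral becomes
    part of an integrand on the plane, as Tonelli's theorem requires. *)
Let triangle (z : R * R) : R := ((0 < z.2) && (z.2 < z.1))%:R.

Let measurable_triangle : measurable_fun setT triangle.
Proof.
have -> : triangle = \1_[set z : R * R | (0 < z.2) && (z.2 < z.1)].
  by apply/funext => z; rewrite indicE/= /triangle; congr ((nat_of_bool _)%:R);
    apply/idP/idP; [move=> h; rewrite mem_set|move/set_mem].
apply: measurable_indic.
have m1 : measurable_fun setT (fun z : R * R => 0 < z.2).
  by apply: measurable_fun_ltr => //; exact: measurable_snd.
have m2 : measurable_fun setT (fun z : R * R => z.2 < z.1).
  by apply: measurable_fun_ltr; [exact: measurable_snd|exact: measurable_fst].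
have := measurable_and m1 m2 measurableT (Y := [set true]) I.
by rewrite setTI.
Qed.

Let integral_triangle (F : R -> R) t :
  (\int[leb]_(s in `]0%R, t[) (F s)%:E = \int[leb]_s (triangle (t, s) * F s)%:E)%E.
Proof.
rewrite integral_mkcond; apply: eq_integral => s _; rewrite patchE /triangle/=.
have [/set_mem/=|/negP ns] := boolP (s \in _).
  by rewrite in_itv/= => ->; rewrite mul1r.
case: (boolP (_ && _)) => [st|_]; last by rewrite mul0r.
by exfalso; apply: ns; rewrite mem_set//= in_itv.
Qed.

Lemma measurable_integral_0 (F : R -> R) :
  measurable_fun setT F -> (forall s, 0 <= F s) ->
  measurable_fun setT (fun t => \int[leb]_(s in `]0%R, t[) (F s)%:E)%E.
Proof.
move=> mF F0.
rewrite (_ : (fun t => _) =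
    fubini_F leb (fun z : R * R => (triangle z * F z.2)%:E)); last first.
  by apply/funext => t; rewrite integral_triangle.
apply: measurable_fun_fubini_tonelli_F => [|z].
  apply/measurable_EFinP; apply: measurable_funM => //.
  exact: (measurableT_comp mF measurable_snd).
by rewrite lee_fin mulr_ge0// /triangle.
Qed.

(** After the exchange of integrals, [t^(- r - 1)] is integrated over [t > s] and gives
    [s^(- r) / r], which cancels [s^r]. *)
Lemma tonelli_powR (F : R -> R) r :
  measurable_fun setT F -> (forall s, 0 <= F s) -> 0 < r ->
  (\int[leb]_(t in `]0%R, +oo[) ((t `^ (- r - 1))%:E *
     \int[leb]_(s in `]0%R, t[) (s `^ r * F s)%:E) <=
   (r^-1)%:E * \int[leb]_(s in `]0%R, +oo[) (F s)%:E)%E.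
Proof.
move=> mF F0 r0.
pose f (z : R * R) : \bar R := (triangle z * (z.1 `^ (- r - 1) * (z.2 `^ r * F z.2)))%:E.
have mf : measurable_fun setT f.
  apply/measurable_EFinP; apply: measurable_funM => //.
  apply: measurable_funM.
    exact: (measurableT_comp (measurable_powR (- r - 1)) measurable_fst).
  apply: measurable_funM.
    exact: (measurableT_comp (measurable_powR r) measurable_snd).
  exact: (measurableT_comp mF measurable_snd).
have f0 z : (0 <= f z)%E by rewrite lee_fin /triangle !mulr_ge0 ?powR_ge0.
have -> : (\int[leb]_(t in `]0%R, +oo[) ((t `^ (- r - 1))%:E *
     \int[leb]_(s in `]0%R, t[) (s `^ r * F s)%:E) =
     \int[leb]_t \int[leb]_s f (t, s))%E.
  rewrite integral_mkcond; apply: eq_integral => t _; rewrite patchE.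
  case: ifPn => [_|/negP t0].
    rewrite -ge0_integralZl_EFin ?powR_ge0//; last 2 first.
    - by move=> s _; rewrite lee_fin mulr_ge0 ?powR_ge0.
    - apply/measurable_EFinP; apply: measurable_funM; first exact: measurable_powR_mul.
      exact: measurable_funTS.
    under eq_integral do rewrite -EFinM.
    by rewrite integral_triangle.
  rewrite integral0_eq// => s _; rewrite /f /triangle/=.
  case: (boolP (_ && _)) => [/andP[s0 st]|_]; last by rewrite mul0r.
  by exfalso; apply: t0; rewrite mem_set//= in_itv/= andbT (lt_trans s0).
have ri0 : 0 <= r^-1 by rewrite invr_ge0 ltW.
rewrite fubini_tonelli// -ge0_integralZl_EFin//; last 2 first.
- by move=> s _; rewrite lee_fin.
- by apply/measurable_EFinP; exact: measurable_funTS.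
rewrite [X in (_ <= X)%E]integral_mkcond.
apply: ae_le_ge0_integral => //.
- by move=> s _; exact: integral_ge0.
- by move=> s _; apply: erestrict_ge0 => x _; rewrite mule_ge0 ?lee_fin.
apply: aeW => s _; rewrite patchE; case: ifPn => [/set_mem/=|/negP s0].
  rewrite in_itv/= andbT => s0.
  rewrite (_ : (\int[leb]_x f (x, s))%E = ((s `^ r * F s)%:E *
      \int[leb]_(t in `]s, +oo[) (t `^ (- r - 1))%:E)%E); last first.
    rewrite -ge0_integralZl_EFin ?mulr_ge0 ?powR_ge0//; last 2 first.
    - by move=> t _; rewrite lee_fin powR_ge0.
    - by apply/measurable_EFinP; exact: measurable_powR_mul.
    rewrite [RHS]integral_mkcond; apply: eq_integral => t _.
    rewrite patchE /f /triangle/= s0/=.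
    have [/set_mem/=|/negP ns] := boolP (t \in _).
      by rewrite in_itv/= andbT => ->; rewrite mul1r -EFinM mulrC.
    case: (boolP (_ < _)) => [st|_]; last by rewrite mul0r.
    by exfalso; apply: ns; rewrite mem_set//= in_itv/= st.
  have r1 : - r - 1 + 1 < 0 by rewrite subrK oppr_lt0.
  apply: (le_trans (lee_wpmul2l _ (integral_powR_y s0 r1))).
    by rewrite lee_fin mulr_ge0 ?powR_ge0.
  rewrite subrK opprK -!EFinM lee_fin powRN.
  rewrite (_ : _ * _ = r^-1 * F s)//; field.
  by rewrite !gt_eqF ?powR_gt0.
rewrite integral0_eq// => t _; rewrite /f /triangle/=.
case: (boolP (_ && _)) => [/andP[s1 st]|_]; last by rewrite mul0r.
by exfalso; apply: s0; rewrite mem_set//= in_itv/= andbT.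
Qed.

Lemma hardy_inequality p q a : 0 < p -> 0 < q -> p^-1 + q^-1 = 1 -> a < q^-1 ->
  exists2 C : R, 0 <= C & forall G, measurable_fun setT G -> (forall s, 0 <= G s) ->
  (\int[leb]_(t in `]0%R, +oo[) ((t `^ (a - 1))%:E *
     \int[leb]_(s in `]0%R, t[) (s `^ (- a) * G s)%:E) `^ p <=
   C%:E * \int[leb]_(s in `]0%R, +oo[) (G s `^ p)%:E)%E.
Proof.
move=> p0 q0 pq aq.
(* Any [c] with [- q^-1 < c < - a] would do: the first inequality makes [s ^ (c q)]
   integrable at 0, the second makes the outer integral converge at infinity. *)
pose c := (- a - q^-1) / 2; pose k := c * q + 1; pose r := - (p * (a + c)).
have ac : a + c < 0 by rewrite /c; lra.
have r0 : 0 < r by rewrite /r oppr_gt0 pmulr_rlt0.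
have k0 : 0 < k.
  rewrite /k -ltrBlDr sub0r -ltr_pdivrMr// mulN1r /c; lra.
have k0' := ltW k0.
pose K := k^-1 `^ (p / q).
exists (K * r^-1) => [|G mG G0]; first by rewrite mulr_ge0 ?powR_ge0// invr_ge0 ltW.
have mGp : measurable_fun setT (fun s => G s `^ p).
  by apply: (measurableT_comp (measurable_powR p)).
have mKGp : measurable_fun setT (fun s => K * G s `^ p) by exact: measurable_funM.
have K0 : 0 <= K by rewrite powR_ge0.
have KGp0 s : 0 <= K * G s `^ p by rewrite mulr_ge0 ?powR_ge0.
have -> : ((K * r^-1)%:E * \int[leb]_(s in `]0%R, +oo[) (G s `^ p)%:E =
    (r^-1)%:E * \int[leb]_(s in `]0%R, +oo[) (K * G s `^ p)%:E)%E.
  under [in RHS]eq_integral do rewrite EFinM.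
  rewrite [in RHS]ge0_integralZl_EFin//; last 2 first.
  - by move=> s _; rewrite lee_fin powR_ge0.
  - by apply/measurable_EFinP; exact: measurable_funTS.
  by rewrite muleA -EFinM mulrC.
apply: le_trans (tonelli_powR mKGp KGp0 r0).
apply: ae_le_ge0_integral => //.
- by move=> t _; exact: poweR_ge0.
- move=> t _; rewrite mule_ge0 ?lee_fin ?powR_ge0//.
  by apply: integral_ge0 => s _; rewrite lee_fin mulr_ge0 ?powR_ge0.
apply: aeW => t /=; rewrite in_itv/= andbT => t0.
rewrite poweRM ?lee_fin ?powR_ge0//; last first.
  by apply: integral_ge0 => s _; rewrite lee_fin mulr_ge0 ?powR_ge0.
apply: (le_trans (lee_wpmul2l (poweR_ge0 _ _) (hoelder_powR _ mG G0 p0 q0 pq t0 k0))).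
rewrite (_ : (- a - c) * p = r); last by rewrite /r; ring.
have -> : (\int[leb]_(s in `]0%R, t[) (s `^ r * (K * G s `^ p))%:E =
    K%:E * \int[leb]_(s in `]0%R, t[) (s `^ r * G s `^ p)%:E)%E.
  under eq_integral do rewrite mulrCA EFinM.
  rewrite ge0_integralZl_EFin//.
  - by move=> s _; rewrite lee_fin mulr_ge0 ?powR_ge0.
  - by apply/measurable_EFinP; apply: measurable_funM;
      [exact: measurable_powR_mul|exact: measurable_funTS].
rewrite !muleA lee_wpmul2r//.
  by apply: integral_ge0 => s _; rewrite lee_fin mulr_ge0 ?powR_ge0.
rewrite poweR_EFin -!EFinM lee_fin powRM ?powR_ge0 ?invr_ge0// mulrA -/K mulrC.
rewrite -!powRrM -powR_gt0D// -/k.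
(* The powers of [t] from the weight and from Hölder's factor combine to the exponent of
   [tonelli_powR], because [p / q = p - 1]. *)
rewrite (_ : (a - 1) * p + k * (p / q) = - r - 1); first by rewrite mulrC.
have p1 : p * p^-1 = 1 by rewrite divff// gt_eqF.
have q1 : q * q^-1 = 1 by rewrite divff// gt_eqF.
have pq1 : p * q^-1 = p - 1.
  by rewrite (_ : q^-1 = 1 - p^-1) ?mulrBr ?p1 ?mulr1// -pq addrAC subrr add0r.
rewrite /k (_ : _ + _ * (p / q) = (a - 1) * p + c * p * (q * q^-1) + p * q^-1).
  by rewrite q1 pq1 /r; ring.
by ring.
Qed.

End Hardy.

(** * Weighted Lebesgue spaces and convolutions *)

Section AlmostEverywhere.
Context {d : measure_display} {T : measurableType d} {R : realType}.
Variable mu : {measure set T -> \bar R}.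

Lemma ae_imply (P Q : T -> Prop) : (forall t, P t -> Q t) ->
  {ae mu, forall t, P t} -> {ae mu, forall t, Q t}.
Proof. by move=> PQ; apply: filterS. Qed.

Lemma ae_imply2 (P Q S : T -> Prop) : (forall t, P t -> Q t -> S t) ->
  {ae mu, forall t, P t} -> {ae mu, forall t, Q t} -> {ae mu, forall t, S t}.
Proof. by move=> PQS; apply: filterS2. Qed.

End AlmostEverywhere.

Section Preparation.
Context {R : realType}.
Local Notation leb := (@lebesgue_measure R).
Implicit Types (E : normedModType R[i]) (D : set R).

Lemma one_sub_exp_le (x : R) n : 0 <= x -> x <= 1 -> 1 - x ^+ n <= n%:R * (1 - x).
Proof.
move=> x0 x1; elim: n => [|n IH]; first by rewrite expr0 subrr mul0r.
rewrite exprS -natr1 mulrDl mul1r.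
have := ler_wpM2r (_ : 0 <= 1 - x) (exprn_ile1 n x0 x1).
rewrite subr_ge0 mul1r => /(_ x1); rewrite mulrBr mulr1 (mulrC _ x) => h.
by apply: (le_trans _ (lerD IH h)); rewrite addrA subrK.
Qed.

(** Rounding the exponent up to the integer [n] only decreases a power of [x <= 1], and reduces the
    claim to Bernoulli's inequality. *)
Lemma one_sub_powR_le (x h : R) n : 0 < x -> x <= 1 -> 0 <= h -> h <= n%:R ->
  1 - x `^ h <= n%:R * (1 - x).
Proof.
move=> x0 x1 h0 hn; apply: le_trans (one_sub_exp_le n (ltW x0) x1).
by rewrite lerD2l lerN2 -powR_mulrn ?(ltW x0)// ger_powR// x0.
Qed.

(** For [g < 0] the identity [x^g - 1 = x^g (1 - x^(-g))] leads back to a positive exponent; the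
    factor [1 + x^g] covers both signs. *)
Lemma abs_one_sub_powR_le (x g : R) n : 0 < x -> x <= 1 -> `|g| <= n%:R ->
  `|1 - x `^ g| <= n%:R * (1 - x) * (1 + x `^ g).
Proof.
move=> x0 x1 gn; have xg0 : 0 < x `^ g by rewrite powR_gt0.
have nx0 : 0 <= n%:R * (1 - x) by rewrite mulr_ge0// subr_ge0.
have [g0|g0] := leP 0 g.
  have xg1 : x `^ g <= 1 by rewrite -(powRr0 x) ger_powR// x0.
  rewrite ger0_norm ?subr_ge0//; rewrite ger0_norm// in gn.
  apply: (le_trans (one_sub_powR_le x0 x1 g0 gn)).
  by rewrite ler_peMr// lerDl ltW.
have xg1 : 1 <= x `^ g by rewrite -[leLHS](powRr0 x) ger_powR ?x0// ltW.
rewrite ler0_norm ?subr_le0// opprB; rewrite ltr0_norm// in gn.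
have Ng0 : 0 <= - g by rewrite oppr_ge0 ltW.
have := ler_wpM2r (ltW xg0) (one_sub_powR_le x0 x1 Ng0 gn).
rewrite mulrBl mul1r -powR_gt0D// addNr powRr0 => h.
by apply: (le_trans h); rewrite ler_wpM2l// lerDr.
Qed.

Lemma ge0_integral_abs_continuous D (f : R -> R) (e : R) : measurable D ->
  measurable_fun setT f -> (forall t, 0 <= f t) ->
  (\int[leb]_(t in D) (f t)%:E < +oo)%E -> 0 < e ->
  exists2 d : R, 0 < d & forall A, measurable A -> A `<=` D ->
    (leb A < d%:E)%E -> (\int[leb]_(t in A) (f t)%:E < e%:E)%E.
Proof.
move=> mD mf f0 fD e0.
pose h t := \1_D t * f t.
have mh : measurable_fun setT h by apply: measurable_funM.
have h0 t : 0 <= h t by rewrite mulr_ge0// indicE.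
have hA A : A `<=` D -> (\int[leb]_(t in A) (h t)%:E = \int[leb]_(t in A) (f t)%:E)%E.
  move=> AD; apply: eq_integral => t /set_mem /AD Dt.
  by rewrite /h indicE mem_set// mul1r.
have intf : leb.-integrable setT (EFin \o h).
  apply/integrableP; split; first exact/measurable_EFinP.
  rewrite (_ : (\int[leb]_x `|(EFin \o h) x|)%E = (\int[leb]_(t in D) (f t)%:E)%E)//.
  rewrite [RHS]integral_mkcond; apply: eq_integral => t _ /=.
  rewrite ger0_norm// patchE /h indicE.
  by case: ifPn => _; rewrite ?mul1r ?mul0r.
have [d [d0 hd]] := integral_normr_continuous intf e0.
exists d => // A mA AD Ad; have := hd A mA Ad.
rewrite /Rintegral; under eq_integral do rewrite ger0_norm//.
rewrite hA// => h1; rewrite -(@fineK _ (\int[leb]_(t in A) (f t)%:E)%E) ?lte_fin//.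
rewrite ge0_fin_numE; last by apply: integral_ge0 => t _; rewrite lee_fin.
apply: le_lt_trans fD; apply: ge0_subset_integral => //.
- by apply/measurable_EFinP; exact: measurable_funTS.
- by move=> t _; rewrite lee_fin.
Qed.

Lemma ge0_integral_subset_le D D' (f : R -> \bar R) :
  D `<=` D' -> (forall t, (0 <= f t)%E) ->
  (\int[leb]_(t in D) f t <= \int[leb]_(t in D') f t)%E.
Proof.
move=> DD' f0; rewrite integral_mkcond [X in (_ <= X)%E]integral_mkcond.
apply: ae_le_ge0_integral => //.
- by move=> t _; exact: erestrict_ge0.
- by move=> t _; exact: erestrict_ge0.
apply: aeW => t _; rewrite !patchE; case: ifPn => [/set_mem/DD' Dt|_].
  by rewrite mem_set.
by case: ifPn.
Qed.

Lemma strongly_measurable_cvg {E} D (f : nat -> R -> E) (g : R -> E) :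
  measurable D -> (forall n, strongly_measurable leb D (f n)) ->
  {ae leb, forall t, D t -> f n t @[n --> \oo] --> g t} ->
  strongly_measurable leb D g.
Proof.
move=> mD smf fg.
have /choice[h hP] : forall n, exists h, sm h /\
    {ae leb, forall t, D t -> f n t = h t}.
  by move=> n; have /(strongly_measurableP leb _ mD)[h ? ?] := smf n; exists h.
have /ae_foralln hf : forall n, {ae leb, forall t, D t -> f n t = h n t}.
  by move=> n; case: (hP n).
have [N [mN N0 hN]] : {ae leb, forall t, D t -> h n t @[n --> \oo] --> g t}.
  apply: ae_imply2 fg hf => t fg hf Dt; have := fg Dt.
  by under eq_fun do rewrite hf//.
apply/strongly_measurableP => //; exists (restrict0 (D `\` N) g); last first.
  exists N; split=> // t /= ht; apply: contrapT => Nt; apply: ht => Dt.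
  by rewrite /restrict0 mem_set.
apply: (sm_cvg (f := fun n => restrict0 (D `\` N) (h n))) => [n|t].
  by apply: sm_restrict0; [exact: measurableD|case: (hP n)].
rewrite /restrict0; case: ifPn => [|_]; last exact: cvg_cst.
by rewrite inE => -[Dt Nt]; apply: contrapT => ht; apply: Nt; apply: hN => /= /(_ Dt).
Qed.

Lemma strongly_measurable_scale {E} D (a : R -> R) (f : R -> E) :
  measurable D -> measurable_fun setT a -> strongly_measurable leb D f ->
  strongly_measurable leb D (fun t => (a t)%:C%C *: f t).
Proof.
move=> mD ma /(strongly_measurableP leb _ mD)[g sg fg].
apply/strongly_measurableP => //; exists (fun t => (a t)%:C%C *: g t).
  exact: sm_scale.
by apply: ae_imply fg => t fg /fg ->.
Qed.

Lemma strongly_measurable_eq {E} D (f g : R -> E) : measurable D ->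
  (forall t, D t -> f t = g t) -> strongly_measurable leb D f ->
  strongly_measurable leb D g.
Proof.
move=> mD fg /(strongly_measurableP leb _ mD)[h sh fh].
apply/strongly_measurableP => //; exists h => //.
by apply: ae_imply fh => t fh Dt; rewrite -fg// fh.
Qed.

Lemma strongly_measurable_subset {E} D D' (f : R -> E) : D `<=` D' ->
  strongly_measurable leb D' f -> strongly_measurable leb D f.
Proof.
move=> DD' [s [ss sf]]; exists s; split=> //.
by apply: ae_imply sf => t sf /DD' /sf.
Qed.

End Preparation.

Section WeightedSpaces.
Context {R : realType} {E : normedModType R[i]}.
Local Notation leb := (@lebesgue_measure R).
Local Notation Rplus := (`]0%R, +oo[%classic : set R).
Implicit Types (a b p t : R) (f : R -> E).

Lemma weightedK a f t : 0 < t -> weighted (- a) (weighted a f) t = f t.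
Proof.
move=> t0; rewrite /weighted scalerA -rmorphM -powR_gt0D// addNr powRr0.
by rewrite scale1r.
Qed.

Lemma rnorm_weighted a f t : rnorm (weighted a f t) = t `^ a * rnorm (f t).
Proof. by rewrite rnormZ ger0_norm// powR_ge0. Qed.

Lemma strongly_measurable_weighted a f :
  strongly_measurable leb Rplus (weighted a f) <-> strongly_measurable leb Rplus f.
Proof.
have h c (g : R -> E) : strongly_measurable leb Rplus g ->
    strongly_measurable leb Rplus (weighted c g).
  by apply: strongly_measurable_scale => //; exact: measurable_powR.
split=> [/(h (- a))|]; last exact: h.
apply: strongly_measurable_eq => // t; rewrite /= in_itv/= andbT.
exact: weightedK.
Qed.

Lemma poweR_Lpw_norm p a f : 0 < p ->
  (Lpw_norm p a f `^ p = \int[leb]_(t in Rplus) ((t `^ a * rnorm (f t)) `^ p)%:E)%E.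
Proof.
move=> p0; rewrite /Lpw_norm /Lp_norm poweR_Lnorm ?gt_eqF//.
rewrite [RHS]integral_mkcond; apply: eq_integral => t _; rewrite !patchE.
case: ifPn => _; last by rewrite /= normr0 powR0// gt_eqF.
by rewrite rnorm_weighted /= ger0_norm// mulr_ge0 ?powR_ge0 ?rnorm_ge0.
Qed.

Lemma Lpw_norm_ge0 p a f : (0 <= Lpw_norm p a f)%E.
Proof. exact: Lnorm_ge0. Qed.

Lemma Lpw_norm_lty p a f : 0 < p ->
  (Lpw_norm p a f < +oo)%E <->
  (\int[leb]_(t in Rplus) ((t `^ a * rnorm (f t)) `^ p)%:E < +oo)%E.
Proof.
move=> p0; rewrite -poweR_Lpw_norm//; split; first exact: poweR_lty.
by apply: lty_poweRy; rewrite gt_eqF.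
Qed.

End WeightedSpaces.

(** * Improper convolutions and the change of weight *)

Section Convolution.
Context {R : realType}.
Local Notation leb := (@lebesgue_measure R).
Implicit Types (a b g p t e : R).

(** An absolutely convergent integral is also an improper one in the sense of [is_convolution_at]:
    the part over [[t - r, t[] tends to 0 by absolute continuity. *)
Lemma bochner_cvg_left {E : normedModType R[i]} (f : R -> E) t v (W : R -> E) :
  0 < t -> is_bochner_integral leb `]0%R, t[ f v ->
  (\int[leb]_(s in `]0%R, t[) (rnorm (f s))%:E < +oo)%E ->
  (forall e, 0 < e < t -> is_bochner_integral leb `]0%R, (t - e)[ f (W e)) ->
  W e @[e --> 0^'+] --> v.
Proof.
move=> t0 fv ffin fW.
have mI (a b : R) : measurable (`]a, b[%classic : set (measurableTypeR R)) by [].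
have [g [sg fg _]] := bochner_sm (mI 0 t) fv.
have ifg A : measurable A -> A `<=` `]0%R, t[ ->
    (\int[leb]_(s in A) (rnorm (f s))%:E = \int[leb]_(s in A) (rnorm (g s))%:E)%E.
  move=> mA AD; apply: ae_eq_ge0_integral => //; try by move=> s _; exact: rnormE_ge0.
  by apply: ae_imply fg => s fg /AD /fg ->.
rewrite ifg// in ffin.
apply/cvg_rnormP/cvgrPdist_lt => e e0.
have [d d0 hd] := ge0_integral_abs_continuous (mI 0 t) (sm_rnorm sg)
  (fun s => rnorm_ge0 (g s)) ffin e0.
near=> r; have r0 : 0 < r by [].
have rt : r < t by near: r; exact: nbhs_right_lt.
have rd : r < d by near: r; exact: nbhs_right_lt.
rewrite sub0r normrN ger0_norm ?rnorm_ge0// rnormB -lte_fin.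
have sub : `]0%R, (t - r)[%classic `<=` (`]0%R, t[%classic : set R).
  by move=> s /=; rewrite !in_itv/= => /andP[-> /lt_trans]; apply; rewrite ltrBlDr ltrDl.
have rr : 0 < r < t by rewrite r0.
apply: le_lt_trans (bochner_subset (mI 0 t) (mI 0 (t - r)) sub fv (fW r rr)) _.
have sub' : `]0%R, t[%classic `\` `]0%R, (t - r)[%classic `<=` (`[t - r, t[%classic : set R).
  move=> s [] /=; rewrite !in_itv/= => /andP[s0 st]; rewrite s0 st andbT/=.
  by move/negP; rewrite -leNgt.
rewrite ifg//; last exact: measurableD.
apply: hd; [exact: measurableD|by move=> s []|].
apply: (@le_lt_trans _ _ (leb `[(t - r)%R, t[)%E).
  by apply: le_measure; rewrite ?inE//; exact: measurableD.
by rewrite lebesgue_measure_itv/= lte_fin ltrBlDr ltrDl r0 -EFinD lte_fin opprB addrCA subrr addr0.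
Unshelve. all: by end_near.
Qed.

Section Kernel.
Context {U : normedModType R[i]} {Y : completeNormedModType R[i]}.
Variables (K : R -> U -> Y) (M : R).
Hypothesis M0 : 0 < M.
Hypothesis K_scale : forall t c u, 0 < t -> K t (c%:C%C *: u) = c%:C%C *: K t u.
Hypothesis K_le : forall t u, 0 < t -> rnorm (K t u) <= M / t * rnorm u.

Lemma convolution_ae_eq (u1 u2 : R -> U) t y :
  {ae leb, forall s, 0 < s -> u1 s = u2 s} ->
  is_convolution_at K u1 t y -> is_convolution_at K u2 t y.
Proof.
move=> u12 [J [JK Jy]]; exists J; split => // e /JK.
apply: bochner_ae_eq => //; apply: ae_imply u12 => s u12 /=.
by rewrite in_itv/= => /andP[/u12 -> _].
Qed.

(** The bound holds for the integrals over [(0, t - e)] with a right-hand side independent of [e],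
    hence for their limits. Additivity of [K t] is not among the assumptions of this section, so the
    difference is taken after applying it. *)
Lemma convolution_dist (u1 u2 : R -> U) t y1 y2 (th : R -> R) : 0 < t ->
  is_convolution_at K u1 t y1 -> is_convolution_at K u2 t y2 ->
  (forall s, 0 <= th s) ->
  (forall s, 0 < s < t -> rnorm (K (t - s) (u1 s) - K (t - s) (u2 s)) <= th s) ->
  ((rnorm (y1 - y2))%:E <= \int[leb]_(s in `]0%R, t[) (th s)%:E)%E.
Proof.
move=> t0 [J1 [J1K J1y]] [J2 [J2K J2y]] th0 Kth.
have Jle e : 0 < e < t ->
    ((rnorm (J1 e - J2 e))%:E <= \int[leb]_(s in `]0%R, t[) (th s)%:E)%E.
  move=> et; have mI : measurable (`]0, t - e[%classic : set (measurableTypeR R)) by [].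
  have := bochner_norm mI (bochnerD (-1) mI (J1K e et) (J2K e et)).
  rewrite rmorphN1 scaleN1r; move=> /le_trans; apply.
  apply: (@le_trans _ _ (\int[leb]_(s in `]0%R, (t - e)%R[) (th s)%:E)%E).
    apply: ae_le_ge0_integral => //.
    - by move=> s _; rewrite lee_fin rnorm_ge0.
    - by move=> s _; rewrite lee_fin.
    apply: aeW => s /=; rewrite in_itv/= => /andP[s0 st].
    rewrite lee_fin scaleN1r; apply: Kth; rewrite s0/=.
    by apply: (lt_trans st); rewrite ltrBlDr ltrDl; case/andP: et.
  apply: ge0_integral_subset_le => s; last by rewrite lee_fin.
  rewrite /= !in_itv/= => /andP[-> /lt_trans]; apply.
  by rewrite ltrBlDr ltrDl; case/andP: et.
have [->|thfin] := eqVneq (\int[leb]_(s in `]0%R, t[) (th s)%:E)%E +oo%E.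
  by rewrite leey.
have thf : (\int[leb]_(s in `]0%R, t[) (th s)%:E)%E \is a fin_num.
  by rewrite ge0_fin_numE ?ltey//; apply: integral_ge0 => s _; rewrite lee_fin.
rewrite -(fineK thf) lee_fin leNgt; apply/negP => hlt.
have Jc : rnorm (J1 e - J2 e) @[e --> 0^'+] --> rnorm (y1 - y2).
  by apply: cvg_rnorm; exact: cvgB.
have hn := cvgr_gt _ Jc _ hlt.
suff : \forall e \near (0 : R)^'+, False by move/filter_ex => [].
near=> e.
have et : 0 < e < t by apply/andP; split => //; near: e; exact: nbhs_right_lt.
have := Jle e et; rewrite -(fineK thf) lee_fin leNgt => /negP; apply.
by near: e; exact: hn.
Unshelve. all: by end_near.
Qed.

(* Changing the weight by [s ^ g] changes the convolution at [t] by an integral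
   against [K (t - s) (1 - (s / t) ^ g)], in which the singularity of [K] at
   [s = t] is cancelled. *)
Lemma convolution_weighted (u : R -> U) t g n y : 0 < t -> `|g| <= n%:R ->
  sm u ->
  (\int[leb]_(s in `]0%R, t[) (rnorm (u s))%:E < +oo)%E ->
  (\int[leb]_(s in `]0%R, t[) (s `^ g * rnorm (u s))%:E < +oo)%E ->
  is_convolution_at K (weighted g u) t y ->
  exists2 w, is_convolution_at K u t (w + (t `^ (- g))%:C%C *: y) &
    ((rnorm w)%:E <= (n%:R * M / t)%:E *
      (\int[leb]_(s in `]0%R, t[) (rnorm (u s))%:E + (t `^ (- g))%:E *
       \int[leb]_(s in `]0%R, t[) (s `^ g * rnorm (u s))%:E))%E.
Proof.
move=> t0 gn smu fA fB [J [JK Jy]].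
pose F s := K (t - s) (u s).
have mI (a b : R) : measurable (`]a, b[%classic : set (measurableTypeR R)) by [].
have KF e s : 0 < e < t -> `]0%R, (t - e)[%classic s ->
    K (t - s) (weighted g u s) = (s `^ g)%:C%C *: F s.
  move=> /andP[e0 et] /=; rewrite in_itv/= => /andP[s0 ste].
  by rewrite K_scale// subr_gt0 (lt_trans ste)// ltrBlDr ltrDl.
(* The integrals assumed for [weighted g u] include strong measurability of [s^g F]; multiplying by
   [s^(-g)] recovers that of [F]. *)
have mF e : 0 < e < t -> strongly_measurable leb `]0%R, (t - e)[ F.
  move=> et; have [smJ _] := JK e et.
  have := strongly_measurable_scale (mI 0 (t - e)) (measurable_powR (- g)) smJ.
  apply: strongly_measurable_eq => // s sI; rewrite (KF e)// scalerA -rmorphM/=.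
  have s0 : 0 < s by move: sI; rewrite /= in_itv/= => /andP[].
  by rewrite -powR_gt0D// addNr powRr0 scale1r.
have tn n' : 0 < t / n'.+2%:R < t.
  by rewrite divr_gt0//= ltr_pdivrMr// ltr_pMr// ltr1n.
(* Measurability is known only up to [t - e] with [0 < e < t]. The choice [e = t / n'.+2] exhausts
   [(0, t)], and at each [s] the truncations are eventually equal to [F s]. *)
have mFt : strongly_measurable leb `]0%R, t[ F.
  apply: (strongly_measurable_cvg
    (f := fun n' => restrict0 `]0%R, (t - t / n'.+2%:R)[%classic F)) => //.
    by move=> n'; apply: strongly_measurable_restrict0 => //; exact: mF.
  apply: aeW => s /=; rewrite in_itv/= => /andP[s0 st].
  have ts0 : 0 < t - s by rewrite subr_gt0.
  apply: (@cvg_near_cst _ _ _ _ _ _); exists (Num.truncn (t / (t - s))) => // m /= hm.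
  rewrite /restrict0 mem_set//= in_itv/= s0/= ltrBrDr -ltrBrDl.
  rewrite ltr_pdivrMr// mulrC -ltr_pdivrMr//.
  by apply: (lt_le_trans (truncnS_gt _)); rewrite ler_nat !ltnS (leq_trans hm).
pose h s := (1 - t `^ (- g) * s `^ g)%:C%C *: F s.
have mw : measurable_fun setT (fun s : R => 1 - t `^ (- g) * s `^ g).
  apply: measurable_funB => //; apply: measurable_funM => //; exact: measurable_powR.
have mh := strongly_measurable_scale (mI 0 t) mw mFt; rewrite -/h in mh.
have h_le s : 0 < s < t ->
    rnorm (h s) <= n%:R * M / t * (rnorm (u s) + t `^ (- g) * (s `^ g * rnorm (u s))).
  move=> /andP[s0 st]; have ts0 : 0 < t - s by rewrite subr_gt0.
  have st1 : s / t <= 1 by rewrite ler_pdivrMr// mul1r ltW.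
  have sE : s = s / t * t by rewrite divfK// gt_eqF.
  have st0 : 0 < s / t by rewrite divr_gt0.
  have stE : t `^ (- g) * s `^ g = (s / t) `^ g.
    rewrite [in LHS]sE powRM ?(ltW st0) ?(ltW t0)// mulrCA -powR_gt0D// addNr.
    by rewrite powRr0 mulr1.
  rewrite /h rnormZ stE.
  have := ler_pM (normr_ge0 _) (rnorm_ge0 _)
    (abs_one_sub_powR_le st0 st1 gn) (K_le (u s) ts0).
  move=> /le_trans; apply; rewrite -/(F s) mulrA stE le_eqVlt; apply/orP; left.
  apply/eqP; rewrite -[1 - s / t](_ : (t - s) / t = _); last first.
    by rewrite mulrBl divff// gt_eqF.
  by field; rewrite !gt_eqF.
pose c := n%:R * M / t.
have c0 : 0 <= c by rewrite divr_ge0 ?(ltW t0)// mulr_ge0 ?(ltW M0).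
have mu' : measurable_fun setT (fun s => rnorm (u s)) := sm_rnorm smu.
have mgu : measurable_fun setT (fun s => s `^ g * rnorm (u s)).
  by apply: measurable_funM => //; exact: measurable_powR.
have tg0 : 0 <= t `^ (- g) by exact: powR_ge0.
have intE : (\int[leb]_(s in `]0%R, t[)
      (c * (rnorm (u s) + t `^ (- g) * (s `^ g * rnorm (u s))))%:E =
    c%:E * (\int[leb]_(s in `]0%R, t[) (rnorm (u s))%:E + (t `^ (- g))%:E *
       \int[leb]_(s in `]0%R, t[) (s `^ g * rnorm (u s))%:E))%E.
  under eq_integral do rewrite EFinM.
  rewrite ge0_integralZl_EFin//; last 2 first.
  - by move=> s _; rewrite lee_fin addr_ge0 ?mulr_ge0 ?rnorm_ge0 ?powR_ge0.
  - apply/measurable_EFinP; apply: measurable_funTS; apply: measurable_funD => //.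
    exact: measurable_funM.
  congr (_ * _)%E; under eq_integral do rewrite EFinD.
  rewrite ge0_integralD//; last 4 first.
  - by move=> s _; rewrite lee_fin rnorm_ge0.
  - by apply/measurable_EFinP; exact: measurable_funTS.
  - by move=> s _; rewrite lee_fin ?mulr_ge0 ?rnorm_ge0 ?powR_ge0.
  - by apply/measurable_EFinP; apply: measurable_funTS; exact: measurable_funM.
  congr (_ + _)%E; under eq_integral do rewrite EFinM.
  rewrite ge0_integralZl_EFin//.
  - by move=> s _; rewrite lee_fin ?mulr_ge0 ?rnorm_ge0 ?powR_ge0.
  - by apply/measurable_EFinP; exact: measurable_funTS.
have h_int : (\int[leb]_(s in `]0%R, t[) (rnorm (h s))%:E <=
    c%:E * (\int[leb]_(s in `]0%R, t[) (rnorm (u s))%:E + (t `^ (- g))%:E *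
       \int[leb]_(s in `]0%R, t[) (s `^ g * rnorm (u s))%:E))%E.
  rewrite -intE; apply: ae_le_ge0_integral => //.
  - by move=> s _; rewrite lee_fin rnorm_ge0.
  - move=> s _; rewrite lee_fin; apply: (mulr_ge0 c0); apply: addr_ge0.
      exact: rnorm_ge0.
    by rewrite !mulr_ge0 ?powR_ge0 ?rnorm_ge0.
  by apply: aeW => s /=; rewrite in_itv/= lee_fin => /h_le.
have h_fin : (\int[leb]_(s in `]0%R, t[) (rnorm (h s))%:E < +oo)%E.
  apply: (le_lt_trans h_int); rewrite lte_mul_pinfty// lte_add_pinfty//.
  by rewrite lte_mul_pinfty.
have [w hw] := bochner_exists (mI 0 t) mh h_fin.
have /choice[W hW] : forall e, exists W, 0 < e < t ->
    is_bochner_integral leb `]0%R, (t - e)[ h W.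
  move=> e; have [et|] := boolP (0 < e < t); last by exists 0.
  have sub : `]0%R, (t - e)[%classic `<=` (`]0%R, t[%classic : set R).
    move=> s /=; rewrite !in_itv/= => /andP[-> /lt_trans]; apply.
    by rewrite ltrBlDr ltrDl; case/andP: et.
  have [||W hW] := @bochner_exists _ _ _ leb Y `]0%R, (t - e)[%classic h (mI 0 (t - e)).
  - exact: strongly_measurable_subset mh.
  - by apply: le_lt_trans h_fin; apply: ge0_integral_subset_le => // s; rewrite lee_fin rnorm_ge0.
  by exists W.
exists w; last exact: le_trans (bochner_norm (mI 0 t) hw) h_int.
(* On [(0, t - e)] the integrand [F] is the sum of [h] and [t^(-g) s^g F]: the first integrates to
   [W e], the second to [t^(-g)] times [J e]. *)
exists (fun e => W e + (t `^ (- g))%:C%C *: J e); split.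
  move=> e et; have := bochnerD (t `^ (- g)) (mI 0 (t - e)) (hW e et) (JK e et).
  apply: bochner_ae_eq => //; apply: aeW => s sI.
  by rewrite (KF e)// /h scalerA -rmorphM -scalerDl -rmorphD subrK scale1r.
apply: cvgD; first exact: bochner_cvg_left hw h_fin hW.
by apply: cvg_scale_real => //; exact: cvg_cst.
Qed.

End Kernel.
End Convolution.

(** * Integrability on bounded intervals and powers of sums *)

Section LocalIntegrability.
Context {R : realType}.
Local Notation leb := (@lebesgue_measure R).
Implicit Types (a b d g p q t : R).

Lemma hardy_integral_lty (G : R -> R) p q d t :
  measurable_fun setT G -> (forall s, 0 <= G s) ->
  0 < p -> 0 < q -> p^-1 + q^-1 = 1 -> - q^-1 < d -> 0 < t ->
  (\int[leb]_(s in `]0%R, +oo[) (G s `^ p)%:E < +oo)%E ->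
  (\int[leb]_(s in `]0%R, t[) (s `^ d * G s)%:E < +oo)%E.
Proof.
move=> mG G0 p0 q0 pq qd t0 Gfin.
(* The midpoint of [- q^-1] and [d]: above [- q^-1] for Hölder's inequality, and below [d], so that
   [s^((d - c) p)] stays bounded on [(0, t)]. *)
pose c := (d - q^-1) / 2.
have c0 : 0 < c * q + 1.
  rewrite -ltrBlDr sub0r -ltr_pdivrMr// mulN1r /c; lra.
have dc : 0 <= d - c by rewrite /c; lra.
apply: (@lty_poweRy _ _ p); first by rewrite gt_eqF.
apply: (le_lt_trans (hoelder_powR d mG G0 p0 q0 pq t0 c0)).
rewrite lte_mul_pinfty ?lee_fin ?powR_ge0//.
have mGp : measurable_fun setT (fun s => G s `^ p).
  by apply: (measurableT_comp (measurable_powR p)).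
apply: (@le_lt_trans _ _ ((t `^ ((d - c) * p))%:E *
    \int[leb]_(s in `]0%R, +oo[) (G s `^ p)%:E)%E); last first.
  by rewrite lte_mul_pinfty ?lee_fin ?powR_ge0.
apply: (@le_trans _ _ (\int[leb]_(s in `]0%R, t[)
    ((t `^ ((d - c) * p))%:E * (G s `^ p)%:E))%E).
  apply: ae_le_ge0_integral => //.
  - by move=> s _; rewrite lee_fin mulr_ge0 ?powR_ge0.
  - by move=> s _; rewrite mule_ge0 ?lee_fin ?powR_ge0.
  apply: aeW => s /=; rewrite in_itv/= => /andP[s0 st].
  rewrite -EFinM lee_fin ler_wpM2r ?powR_ge0//.
  apply: ge0_ler_powR; rewrite ?nnegrE ?(ltW s0) ?(ltW t0) ?(ltW st)//.
  by rewrite mulr_ge0// ltW.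
rewrite ge0_integralZl_EFin ?powR_ge0//; last 2 first.
- by move=> s _; rewrite lee_fin powR_ge0.
- by apply/measurable_EFinP; exact: measurable_funTS.
apply: lee_wpmul2l; first by rewrite lee_fin powR_ge0.
apply: ge0_integral_subset_le => s; last by rewrite lee_fin powR_ge0.
by rewrite /= !in_itv/= andbT => /andP[].
Qed.

(** An elementary substitute for Minkowski's inequality: the sum is at most three times its largest
    term [m], and [m^p] is one of the terms on the right. *)
Lemma powR_add3_le (x y z p : R) : 0 <= x -> 0 <= y -> 0 <= z -> 0 <= p ->
  (x + y + z) `^ p <= 3 `^ p * (x `^ p + y `^ p + z `^ p).
Proof.
move=> x0 y0 z0 p0; have P0 t : 0 <= t `^ p by exact: powR_ge0.
suff [m [m0 hm mp]] : exists m, [/\ 0 <= m, x + y + z <= 3 * m &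
    m `^ p <= x `^ p + y `^ p + z `^ p].
  apply: (@le_trans _ _ ((3 * m) `^ p)).
    by apply: ge0_ler_powR; rewrite ?nnegrE ?addr_ge0// mulr_ge0.
  by rewrite powRM// ler_wpM2l.
have [xy|/ltW yx] := leP x y; have [yz|/ltW zy] := leP y z.
- by exists z; split=> //; [lra|rewrite lerDr addr_ge0].
- by exists y; split=> //; [lra|rewrite -addrA addrCA lerDl addr_ge0].
- have [xz|/ltW zx] := leP x z.
    by exists z; split=> //; [lra|rewrite lerDr addr_ge0].
  by exists x; split=> //; [lra|rewrite -addrA lerDl addr_ge0].
- by exists x; split=> //; [lra|rewrite -addrA lerDl addr_ge0].
Qed.

End LocalIntegrability.

Section WeightedNorm.
Context {R : realType} {E : normedModType R[i]}.
Local Notation leb := (@lebesgue_measure R).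
Local Notation Rplus := (`]0%R, +oo[%classic : set R).
Implicit Types (a b p t : R) (f g : R -> E).

Lemma Lpw_normE p a f : 0 < p -> Lpw_norm p a f =
  ((\int[leb]_(t in Rplus) ((t `^ a * rnorm (f t)) `^ p)%:E) `^ p^-1)%E.
Proof.
move=> p0; rewrite -poweR_Lpw_norm// -poweRrM mulfV ?gt_eqF//.
by rewrite poweRe1// Lpw_norm_ge0.
Qed.

Lemma Lpw_norm_ae_eq p a b f g : 0 < p ->
  {ae leb, forall t, Rplus t -> t `^ a * rnorm (f t) = t `^ b * rnorm (g t)} ->
  Lpw_norm p a f = Lpw_norm p b g.
Proof.
move=> p0 fg; rewrite (Lpw_normE a f p0) (Lpw_normE b g p0).
apply: (congr1 (fun x => (x `^ p^-1)%E)); apply: ae_eq_ge0_integral => //.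
- by move=> t _; rewrite lee_fin powR_ge0.
- by move=> t _; rewrite lee_fin powR_ge0.
by apply: ae_imply fg => t fg /fg ->.
Qed.

Lemma in_LpwP p a f : 0 < p ->
  in_Lpw p a f <-> strongly_measurable leb Rplus f /\
    (\int[leb]_(t in Rplus) ((t `^ a * rnorm (f t)) `^ p)%:E < +oo)%E.
Proof.
move=> p0; rewrite /in_Lpw /in_Lp strongly_measurable_weighted.
by rewrite -[Lp_norm _ _]/(Lpw_norm p a f) Lpw_norm_lty.
Qed.

End WeightedNorm.

(** * Comparison of the convolution for two weights *)

Lemma powR_le_abs {R : realType} (t h N : R) :
  0 < N -> N^-1 <= t -> t <= N -> t `^ h <= N `^ `|h|.
Proof.
move=> N0 Nt tN; have t0 : 0 < t by apply: lt_le_trans Nt; rewrite invr_gt0.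
have [h0|h0] := leP 0 h.
  by rewrite ger0_norm// ge0_ler_powR ?nnegrE ?(ltW t0) ?(ltW N0).
rewrite ltr0_norm// (_ : t `^ h = t^-1 `^ (- h)); last first.
  by rewrite -powR_inv1 ?(ltW t0)// -powRrM mulN1r opprK.
apply: ge0_ler_powR; rewrite ?nnegrE ?oppr_ge0 ?invr_ge0 ?(ltW t0) ?(ltW h0) ?(ltW N0)//.
by rewrite -[N]invrK lef_pV2 ?posrE ?invr_gt0.
Qed.

Section Transfer.
Context {R : realType}.
Local Notation leb := (@lebesgue_measure R).
Local Notation Rplus := (`]0%R, +oo[%classic : set R).
Context {U : normedModType R[i]} {Y : completeNormedModType R[i]}.
Variables (K : R -> U -> Y) (M : R).
Hypothesis M0 : 0 < M.
Hypothesis K_scale : forall t c u, 0 < t -> K t (c%:C%C *: u) = c%:C%C *: K t u.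
Hypothesis K_le : forall t u, 0 < t -> rnorm (K t u) <= M / t * rnorm u.
Variables (p q a b : R).
Hypotheses (p0 : 0 < p) (q0 : 0 < q) (pq : p^-1 + q^-1 = 1).
Hypotheses (aq : a < q^-1) (bq : b < q^-1).
Let g := b - a.

Section FixedFunction.
Variable u : R -> U.
Hypothesis smu : sm u.
Hypothesis ufin :
  (\int[leb]_(t in Rplus) ((t `^ b * rnorm (u t)) `^ p)%:E < +oo)%E.

(** The hypothesis on [u] says that this scalar function is in [L^p]. The integrals of [u] are
    rewritten as integrals of powers times [G], the form in which the Hölder and Hardy bounds are
    stated. *)
Let G t := t `^ b * rnorm (u t).

Let G0 t : 0 <= G t. Proof. by rewrite mulr_ge0 ?powR_ge0 ?rnorm_ge0. Qed.

Let mG : measurable_fun setT G.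
Proof.
by apply: measurable_funM; [exact: measurable_powR|exact: sm_rnorm].
Qed.

Let powR_G c d t : d = c - b -> 0 < t -> t `^ c * rnorm (u t) = t `^ d * G t.
Proof. by move=> -> t0; rewrite /G mulrA -powR_gt0D// subrK. Qed.

Let integral_powR_G c d t : d = c - b ->
  (\int[leb]_(s in `]0%R, t[) (s `^ c * rnorm (u s))%:E =
   \int[leb]_(s in `]0%R, t[) (s `^ d * G s)%:E)%E.
Proof.
move=> dE; apply: eq_integral => s /set_mem /=; rewrite in_itv/= => /andP[s0 _].
by rewrite (powR_G dE).
Qed.

Let integral_rnormE t :
  (\int[leb]_(s in `]0%R, t[) (rnorm (u s))%:E =
   \int[leb]_(s in `]0%R, t[) (s `^ (- b) * G s)%:E)%E.
Proof.
rewrite -(@integral_powR_G 0); last by rewrite sub0r.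
by apply: eq_integral => s _; rewrite powRr0 mul1r.
Qed.

Let integral_weightedE t :
  (\int[leb]_(s in `]0%R, t[) (s `^ g * rnorm (u s))%:E =
   \int[leb]_(s in `]0%R, t[) (s `^ (- a) * G s)%:E)%E.
Proof. by apply: integral_powR_G; rewrite /g; lra. Qed.

(** In terms of [G] the power is [s^(- b)], so the condition on the weight is [b < q^-1]. For
    [s^g u] the power is [s^(g - b) = s^(- a)], and the condition becomes [a < q^-1]. *)
Lemma integral_rnorm_lty t : 0 < t -> (\int[leb]_(s in `]0%R, t[) (rnorm (u s))%:E < +oo)%E.
Proof.
move=> t0; rewrite integral_rnormE.
by apply: (hardy_integral_lty mG G0 p0 q0 pq) => //; rewrite ltrN2.
Qed.

Lemma integral_weighted_lty t : 0 < t ->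
  (\int[leb]_(s in `]0%R, t[) (s `^ g * rnorm (u s))%:E < +oo)%E.
Proof.
move=> t0; rewrite integral_weightedE.
by apply: (hardy_integral_lty mG G0 p0 q0 pq) => //; rewrite ltrN2.
Qed.

Definition cutoff n : R -> U := restrict0 (`[n.+1%:R^-1, n.+1%:R]%classic : set R) u.

(* Both weights are comparable on [[1 / n, n]], so the hypothesis on the weight
   [a] applies to the cutoffs; their convolutions converge pointwise to that of
   [u], which is therefore strongly measurable. *)
Lemma cutoff_in_Lpw n : in_Lpw p a (cutoff n).
Proof.
have smc : sm (cutoff n) by exact: sm_restrict0.
apply/(in_LpwP _ _ p0); split.
  by apply/strongly_measurableP => //; exists (cutoff n) => //; exact: aeW.
pose c := n.+1%:R `^ `|g|.
have cG t : 0 < t -> (t `^ a * rnorm (cutoff n t)) `^ p <= c `^ p * G t `^ p.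
  move=> t0; rewrite -powRM ?powR_ge0//.
  apply: ge0_ler_powR; rewrite ?nnegrE ?(ltW p0) ?mulr_ge0 ?powR_ge0 ?rnorm_ge0//.
  rewrite /cutoff /restrict0; case: ifPn => [/set_mem/=|_]; last first.
    by rewrite rnorm0 mulr0 mulr_ge0 ?powR_ge0.
  rewrite in_itv/= => /andP[nt tn]; rewrite (@powR_G a (- g)) ?ler_wpM2r//; last first.
    by rewrite /g; lra.
  by rewrite /c -normrN powR_le_abs.
apply: (@le_lt_trans _ _ ((c `^ p)%:E * \int[leb]_(t in Rplus) (G t `^ p)%:E)%E); last first.
  by rewrite lte_mul_pinfty ?lee_fin ?powR_ge0.
rewrite -ge0_integralZl_EFin ?powR_ge0//; last 2 first.
- by move=> t _; rewrite lee_fin powR_ge0.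
- apply/measurable_EFinP; apply: measurable_funTS.
  exact: (measurableT_comp (measurable_powR p) mG).
apply: ae_le_ge0_integral => //.
- by move=> t _; rewrite lee_fin powR_ge0.
- by move=> t _; rewrite mule_ge0 ?lee_fin ?powR_ge0.
by apply: aeW => t /=; rewrite in_itv/= andbT -EFinM lee_fin; exact: cG.
Qed.

(** For large [n] the cutoff differs from [u] on [(0, t)] only below [1 / (n + 1) < t / 2]. There
    [M / (t - s)] is at most [2 M / t], so the singularity is not met, and absolute continuity of
    the integral of [rnorm (u s)] makes the difference small. *)
Lemma cutoff_cvg (vn : nat -> Y) v t : 0 < t ->
  is_convolution_at K u t v ->
  (forall n, is_convolution_at K (cutoff n) t (vn n)) ->
  vn n @[n --> \oo] --> v.
Proof.
move=> t0 Ku Kn; apply/cvg_rnormP/cvgrPdist_lt => e e0.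
pose c := 2 * M / t; have c0 : 0 < c by rewrite divr_gt0 ?mulr_gt0.
have mI (x y : R) : measurable (`]x, y[%classic : set (measurableTypeR R)) by [].
have ec0 : 0 < e / c by rewrite divr_gt0.
have [d d0 hd] := ge0_integral_abs_continuous (mI 0 t) (sm_rnorm smu)
  (fun s => rnorm_ge0 (u s)) (integral_rnorm_lty t0) ec0.
pose m := Num.min d (t / 2); have m0 : 0 < m by rewrite lt_min d0 divr_gt0.
exists (maxn (Num.truncn m^-1) (Num.truncn t)) => // n /=.
rewrite geq_max => /andP[mn tn].
have nm : n.+1%:R^-1 < m.
  rewrite invf_plt ?posrE//; apply: (lt_le_trans (truncnS_gt _)).
  by rewrite ler_nat ltnS.
have nt : t < n.+1%:R by apply: (lt_le_trans (truncnS_gt _)); rewrite ler_nat ltnS.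
move: nm; rewrite lt_min => /andP[nd nt2].
have n0 : 0 < (n.+1%:R^-1 : R) by rewrite invr_gt0.
rewrite sub0r normrN ger0_norm ?rnorm_ge0// rnormB.
pose th s := \1_(`]0, n.+1%:R^-1[%classic : set R) s * (c * rnorm (u s)).
have th0 s : 0 <= th s.
  by apply: mulr_ge0; [rewrite indicE|exact: mulr_ge0 (ltW c0) (rnorm_ge0 _)].
have thle s : 0 < s < t ->
    rnorm (K (t - s) (u s) - K (t - s) (cutoff n s)) <= th s.
  move=> /andP[s0 st]; have ts0 : 0 < t - s by rewrite subr_gt0.
  rewrite /cutoff /restrict0; have [ns|sn] := leP n.+1%:R^-1 s.
    rewrite mem_set; last by rewrite /= in_itv/= ns (ltW (lt_trans st nt)).
    by rewrite subrr rnorm0.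
  rewrite memNset; last by rewrite /= in_itv/= leNgt sn.
  (* Homogeneity with the scalar 0. *)
  have -> : K (t - s) 0 = 0.
    by have := @K_scale (t - s) 0 0 ts0; rewrite !scale0r.
  rewrite subr0 /th indicE mem_set ?mul1r; last by rewrite /= in_itv/= s0.
  apply: (le_trans (K_le _ ts0)); rewrite ler_wpM2r ?rnorm_ge0//.
  rewrite ler_pdivrMr// /c mulrAC ler_pdivlMr// -subr_ge0.
  rewrite (_ : _ - _ = M * (t - 2 * s)); last by ring.
  by rewrite mulr_ge0 ?(ltW M0)//; have := lt_trans sn nt2; lra.
rewrite -lte_fin; apply: (le_lt_trans (convolution_dist t0 Ku (Kn n) th0 thle)).
apply: (@le_lt_trans _ _ (c%:E * \int[leb]_(s in `]0%R, (n.+1%:R^-1)%R[) (rnorm (u s))%:E)%E).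
  rewrite -ge0_integralZl_EFin ?(ltW c0)//; last 2 first.
  - by move=> s _; rewrite lee_fin rnorm_ge0.
  - by apply/measurable_EFinP; apply: measurable_funTS; exact: sm_rnorm.
  apply: (@le_trans _ _ (\int[leb]_s (th s)%:E)%E).
    by apply: ge0_integral_subset_le => // s; rewrite lee_fin.
  rewrite [X in (_ <= X)%E]integral_mkcond.
  rewrite le_eqVlt; apply/orP; left; apply/eqP; apply: eq_integral => s _.
  rewrite patchE /th indicE; case: ifPn => _; rewrite ?mul0r ?mul1r//.
rewrite -lte_pdivlMl// muleC -EFinM.
apply: hd => //.
- move=> s /=; rewrite !in_itv/= => /andP[-> /lt_trans]; apply.
  by apply: (lt_trans nt2); lra.
- rewrite lebesgue_measure_itv/= lte_fin n0 -EFinD lte_fin subr0//.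
Qed.

(** The Hardy average, [1 / t] times the integral over [(0, t)], conjugated by the power of exponent
    [c] and applied to [G]. *)
Let H c t := ((t `^ (c - 1))%:E * \int[leb]_(s in `]0%R, t[) (s `^ (- c) * G s)%:E)%E.

Let integral_powR_G_ge0 c t : (0 <= \int[leb]_(s in `]0%R, t[) (s `^ c * G s)%:E)%E.
Proof. by apply: integral_ge0 => s _; rewrite lee_fin mulr_ge0 ?powR_ge0. Qed.

Let H_ge0 c t : (0 <= H c t)%E.
Proof. by rewrite mule_ge0// lee_fin powR_ge0. Qed.

Let measurable_HX c : measurable_fun setT (fun t => H c t `^ p)%E.
Proof.
apply: (measurableT_comp (measurable_poweR p)).
apply: emeasurable_funM; first by apply/measurable_EFinP; exact: measurable_powR_mul.
apply: measurable_integral_0 => [|s]; last by rewrite mulr_ge0 ?powR_ge0.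
by apply: measurable_funM => //; exact: measurable_powR.
Qed.

(** Since [b - g = a], multiplying the two integrals by [t^b / t] yields exactly [H b] and [H a].
    Both are finite, so the comparison can be made in [R]. *)
Lemma weighted_correction_le n w t : 0 < t ->
  ((rnorm w)%:E <= (n%:R * M / t)%:E *
    (\int[leb]_(s in `]0%R, t[) (rnorm (u s))%:E + (t `^ (- g))%:E *
     \int[leb]_(s in `]0%R, t[) (s `^ g * rnorm (u s))%:E))%E ->
  t `^ b * rnorm (w : Y) <= n%:R * M * fine (H b t) + n%:R * M * fine (H a t).
Proof.
move=> t0; rewrite integral_rnormE integral_weightedE /H.
have := integral_rnorm_lty t0; have := integral_weighted_lty t0.
rewrite integral_rnormE integral_weightedE.
set A := (\int[leb]_(s in _) _)%E; set B := (\int[leb]_(s in _) _)%E => Af Bf.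
have Afin : A \is a fin_num by rewrite (ge0_fin_numE (integral_powR_G_ge0 _ _)).
have Bfin : B \is a fin_num by rewrite (ge0_fin_numE (integral_powR_G_ge0 _ _)).
rewrite -(fineK Afin) -(fineK Bfin) -!EFinM lee_fin /= => wle.
apply: (le_trans (ler_wpM2l (powR_ge0 t b) wle)).
have tb : t `^ b = t `^ (b - 1) * t by rewrite -[X in _ * X]powRr1 ?(ltW t0)// -powR_gt0D// subrK.
have ta : t `^ (a - 1) = t `^ (b - 1) * t `^ (- g).
  by rewrite -powR_gt0D//; congr (_ `^ _); rewrite /g; ring.
rewrite ta tb le_eqVlt; apply/orP; left; apply/eqP; field.
by rewrite gt_eqF.
Qed.

(** No measurability of [w] is available. Only the dominating function, built from [H] and a
    measurable representative of [v], is integrated by linearity; the left side is compared with it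
    pointwise almost everywhere. *)
Lemma convolution_norm_le n (v w : R -> Y) (C Ca Cb : R) :
  strongly_measurable leb Rplus v ->
  {ae leb, forall t, 0 < t -> ((rnorm (w t))%:E <= (n%:R * M / t)%:E *
    (\int[leb]_(s in `]0%R, t[) (rnorm (u s))%:E + (t `^ (- g))%:E *
     \int[leb]_(s in `]0%R, t[) (s `^ g * rnorm (u s))%:E))%E} ->
  (\int[leb]_(t in Rplus) ((t `^ a * rnorm (v t)) `^ p)%:E <=
   C%:E * \int[leb]_(t in Rplus) (G t `^ p)%:E)%E ->
  (\int[leb]_(t in Rplus) (H a t `^ p) <=
   Ca%:E * \int[leb]_(t in Rplus) (G t `^ p)%:E)%E ->
  (\int[leb]_(t in Rplus) (H b t `^ p) <=
   Cb%:E * \int[leb]_(t in Rplus) (G t `^ p)%:E)%E ->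
  (\int[leb]_(t in Rplus)
     ((t `^ b * rnorm (w t + (t `^ (- g))%:C%C *: v t)) `^ p)%:E <=
   (3 `^ p * (C + (n%:R * M) `^ p * Cb + (n%:R * M) `^ p * Ca))%:E *
     \int[leb]_(t in Rplus) (G t `^ p)%:E)%E.
Proof.
have mR : measurable (Rplus : set (measurableTypeR R)) by [].
move=> /(strongly_measurableP leb _ mR)[v' smv' vv'] wle.
have -> : (\int[leb]_(t in Rplus) ((t `^ a * rnorm (v t)) `^ p)%:E =
    \int[leb]_(t in Rplus) ((t `^ a * rnorm (v' t)) `^ p)%:E)%E.
  apply: ae_eq_ge0_integral => //; try by move=> t _; rewrite lee_fin powR_ge0.
  by apply: ae_imply vv' => t vv' /vv' ->.
set k := n%:R * M; set IG := (\int[leb]_(t in _) (G t `^ p)%:E)%E => hv ha hb.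
have k0 : 0 <= k by rewrite mulr_ge0// ltW.
pose f1 t := ((t `^ a * rnorm (v' t)) `^ p)%:E.
have mf1 : measurable_fun setT f1.
  apply/measurable_EFinP; apply: (measurableT_comp (measurable_powR p)).
  by apply: measurable_funM; [exact: measurable_powR|exact: sm_rnorm].
have f10 t : (0 <= f1 t)%E by rewrite lee_fin powR_ge0.
have kp0 : 0 <= k `^ p := powR_ge0 _ _.
have tp0 : 0 <= 3 `^ p :> R := powR_ge0 _ _.
have kH0 c t : (0 <= (k `^ p)%:E * H c t `^ p)%E by rewrite mule_ge0 ?poweR_ge0.
have f1H0 t : (0 <= f1 t + (k `^ p)%:E * H b t `^ p)%E := adde_ge0 (f10 t) (kH0 b t).
have f1HH0 t : (0 <= f1 t + (k `^ p)%:E * H b t `^ p + (k `^ p)%:E * H a t `^ p)%E.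
  exact: adde_ge0 (f1H0 t) (kH0 a t).
have mkH c : measurable_fun setT (fun t => (k `^ p)%:E * H c t `^ p)%E.
  exact: measurable_funeM.
have mf1H := emeasurable_funD mf1 (mkH b).
have mf1HH := emeasurable_funD mf1H (mkH a).
apply: (@le_trans _ _ (\int[leb]_(t in Rplus) ((3 `^ p)%:E *
    (f1 t + (k `^ p)%:E * H b t `^ p + (k `^ p)%:E * H a t `^ p)))%E); last first.
  rewrite ge0_integralZl_EFin//; last first.
    exact: (measurable_funTS mf1HH).
  rewrite EFinM -muleA lee_wpmul2l//.
  rewrite ge0_integralD//; last 2 first.
  - exact: (measurable_funTS mf1H).
  - exact: (measurable_funTS (mkH a)).
  rewrite ge0_integralD//; last 2 first.
  - exact: (measurable_funTS mf1).
  - exact: (measurable_funTS (mkH b)).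
  have mH c : measurable_fun (Rplus : set (measurableTypeR R)) (fun t => H c t `^ p)%E.
    exact: measurable_funTS (measurable_HX c).
  have HX0 c t : (0 <= H c t `^ p)%E by exact: poweR_ge0.
  rewrite !ge0_integralZl_EFin//.
  have IG0 : (0 <= IG)%E by apply: integral_ge0 => t _; rewrite lee_fin powR_ge0.
  (* The constants [C], [Ca], [Cb] carry no sign, so they are distributed in [R], where [IG] is
     finite by [ufin]. *)
  have IGfin : IG \is a fin_num by rewrite ge0_fin_numE.
  move: hv ha hb; rewrite -(fineK IGfin) -!EFinM => hv ha hb.
  rewrite !mulrDl -!mulrA !EFinD; apply: leeD; first apply: leeD => //.
    by rewrite [leRHS]EFinM; apply: lee_wpmul2l.
  by rewrite [leRHS]EFinM; apply: lee_wpmul2l.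
have vw : {ae leb, forall t, 0 < t ->
    t `^ b * rnorm (w t + (t `^ (- g))%:C%C *: v t) <=
    t `^ a * rnorm (v' t) + k * fine (H b t) + k * fine (H a t)}.
  apply: ae_imply2 vv' wle => t vv' wle t0.
  rewrite vv'; last by rewrite /= in_itv/= andbT.
  have := weighted_correction_le t0 (wle t0); rewrite -/k => h.
  rewrite -addrA addrC; apply: le_trans (lerD h (lexx _)).
  rewrite (_ : t `^ a = t `^ b * t `^ (- g)); last first.
    by rewrite -powR_gt0D//; congr (_ `^ _); rewrite /g; ring.
  rewrite -mulrA -mulrDr ler_wpM2l ?powR_ge0//.
  apply: (le_trans (rnormD _ _)); rewrite rnormZ ger0_norm ?powR_ge0//.
apply: ae_le_ge0_integral => //.
- by move=> t _; rewrite lee_fin powR_ge0.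
- by move=> t _; rewrite mule_ge0// !adde_ge0.
apply: ae_imply vw => t vw; rewrite /= in_itv/= andbT => t0.
have Hfin c : c < q^-1 -> H c t \is a fin_num.
  move=> cq; rewrite fin_numM// ge0_fin_numE ?integral_powR_G_ge0//.
  by apply: (hardy_integral_lty mG G0 p0 q0 pq) => //; rewrite ltrN2.
have HE c : c < q^-1 -> (H c t `^ p = (fine (H c t) `^ p)%:E)%E.
  by move=> cq; rewrite -poweR_EFin fineK// Hfin.
have -> : ((3 `^ p)%:E * (f1 t + (k `^ p)%:E * H b t `^ p + (k `^ p)%:E * H a t `^ p) =
    (3 `^ p * ((t `^ a * rnorm (v' t)) `^ p + k `^ p * fine (H b t) `^ p +
      k `^ p * fine (H a t) `^ p))%:E)%E.
  by rewrite (HE a aq) (HE b bq).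
rewrite lee_fin; have {}vw := vw t0.
have fHa0 := fine_ge0 (H_ge0 a t).
have fHb0 := fine_ge0 (H_ge0 b t).
move: (fine (H a t)) (fine (H b t)) fHa0 fHb0 vw => Ha Hb Ha0 Hb0 vw.
have x0 : 0 <= t `^ a * rnorm (v' t) by rewrite mulr_ge0 ?powR_ge0 ?rnorm_ge0.
have y0 : 0 <= k * Hb by rewrite mulr_ge0.
have z0 : 0 <= k * Ha by rewrite mulr_ge0.
have := powR_add3_le x0 y0 z0 (ltW p0).
rewrite (powRM p k0 Hb0) (powRM p k0 Ha0); apply: le_trans.
have h0 : 0 <= t `^ b * rnorm (w t + (t `^ (- g))%:C%C *: v t).
  by rewrite mulr_ge0 ?powR_ge0 ?rnorm_ge0.
exact: (ge0_ler_powR (ltW p0) h0 (addr_ge0 (addr_ge0 x0 y0) z0) vw).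
Qed.

End FixedFunction.
End Transfer.

(** * Transfer of boundedness from one weight to another *)

Section BoundedTransfer.
Context {R : realType}.
Local Notation leb := (@lebesgue_measure R).
Local Notation Rplus := (`]0%R, +oo[%classic : set R).
Context {U : normedModType R[i]} {Y : completeNormedModType R[i]}.
Variables (K : R -> U -> Y) (M : R).
Hypothesis M0 : 0 < M.
Hypothesis K_scale : forall t c u, 0 < t -> K t (c%:C%C *: u) = c%:C%C *: K t u.
Hypothesis K_le : forall t u, 0 < t -> rnorm (K t u) <= M / t * rnorm u.
Variables (p q a b : R).
Hypotheses (p0 : 0 < p) (q0 : 0 < q) (pq : p^-1 + q^-1 = 1).
Hypotheses (aq : a < q^-1) (bq : b < q^-1).

Let mR : measurable (Rplus : set (measurableTypeR R)). Proof. by []. Qed.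

Lemma convolution_transfer_sm : bounded_convolution p a K ->
  exists C : R, forall u : R -> U, sm u -> in_Lpw p b u -> exists v : R -> Y,
    [/\ {ae leb, forall t, 0 < t -> is_convolution_at K u t (v t)},
        strongly_measurable leb Rplus v &
        (\int[leb]_(t in Rplus) ((t `^ b * rnorm (v t)) `^ p)%:E <=
         C%:E * \int[leb]_(t in Rplus) ((t `^ b * rnorm (u t)) `^ p)%:E)%E].
Proof.
move=> [c hc].
have [Ca _ hCa] := hardy_inequality p0 q0 pq aq.
have [Cb _ hCb] := hardy_inequality p0 q0 pq bq.
pose n := (Num.truncn `|b - a|).+1.
have gn : `|b - a| <= n%:R by rewrite ltW// truncnS_gt.
(* [3^p] is the cost of splitting a sum of three terms, [|c|^p] comes from the assumed bound for the
   weight [a], and [Cb], [Ca] come from Hardy's inequality. The absolute value is there because [c]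
   may be negative. *)
exists (3 `^ p * (`|c| `^ p + (n%:R * M) `^ p * Cb + (n%:R * M) `^ p * Ca)).
move=> u smu /(in_LpwP _ _ p0)[_ ufin].
pose u1 := weighted (b - a) u.
have u1E : Lpw_norm p a u1 = Lpw_norm p b u.
  apply: Lpw_norm_ae_eq => //; apply: aeW => t /=; rewrite in_itv/= andbT => t0.
  by rewrite rnorm_weighted mulrA -powR_gt0D// addrC subrK.
have smRu : strongly_measurable leb Rplus u.
  by apply/(strongly_measurableP leb _ mR); exists u => //; exact: aeW.
have u1L : in_Lpw p a u1.
  apply/(in_LpwP _ _ p0); split; first exact/strongly_measurable_weighted.
  by apply/(Lpw_norm_lty _ _ p0); rewrite u1E; apply/(Lpw_norm_lty _ _ p0).
have [v1 [conv1 /(in_LpwP _ _ p0)[smv1 _] v1le]] := hc _ u1L.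
(* The correction is chosen separately for each [t], with the value 0 where the convolution of [u1]
   is not given, so nothing is known here about how [w] depends on [t]. *)
have /choice[w hw] : forall t, exists w : Y, 0 < t -> is_convolution_at K u1 t (v1 t) ->
    is_convolution_at K u t (w + (t `^ (- (b - a)))%:C%C *: v1 t) /\
    ((rnorm w)%:E <= (n%:R * M / t)%:E *
      (\int[leb]_(s in `]0%R, t[) (rnorm (u s))%:E + (t `^ (- (b - a)))%:E *
       \int[leb]_(s in `]0%R, t[) (s `^ (b - a) * rnorm (u s))%:E))%E.
  move=> t; have [t0|t0] := pselect (0 < t); last by exists 0.
  have [cv|ncv] := pselect (is_convolution_at K u1 t (v1 t)); last by exists 0.
  have [w w1 w2] := convolution_weighted M0 K_scale K_le t0 gn smu
    (integral_rnorm_lty p0 q0 pq bq smu ufin t0)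
    (integral_weighted_lty p0 q0 pq aq smu ufin t0) cv.
  by exists w.
pose v t := w t + (t `^ (- (b - a)))%:C%C *: v1 t.
have convv : {ae leb, forall t, 0 < t -> is_convolution_at K u t (v t)}.
  by apply: ae_imply conv1 => t h t0; have [] := hw t t0 (h t0).
exists v; split=> //.
- have /choice[vn hvn] : forall m, exists vn : R -> Y,
      {ae leb, forall t, 0 < t -> is_convolution_at K (cutoff u m) t (vn t)} /\
      in_Lpw p a vn.
    by move=> m; have [vn [? ? _]] := hc _ (cutoff_in_Lpw a p0 smu ufin m); exists vn.
  apply: (strongly_measurable_cvg (f := vn)) => //.
    by move=> m; have [_ /(in_LpwP _ _ p0)[]] := hvn m.
  have /ae_foralln cvn : forall m, {ae leb, forall t, 0 < t ->
      is_convolution_at K (cutoff u m) t (vn m t)} by move=> m; case: (hvn m).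
  apply: ae_imply2 convv cvn => t cv cn; rewrite /= in_itv/= andbT => t0.
  apply: (cutoff_cvg M0 K_scale K_le p0 q0 pq bq smu ufin t0 (cv t0)).
  by move=> m; exact: cn.
apply: (convolution_norm_le M0 p0 q0 pq aq bq smu ufin smv1).
- by apply: ae_imply conv1 => t h t0; have [] := hw t t0 (h t0).
- rewrite -!poweR_Lpw_norm// -u1E -poweR_EFin -poweRM ?Lpw_norm_ge0//.
  apply: le_poweR; rewrite ?(ltW p0) ?Lpw_norm_ge0//.
  apply: (le_trans v1le); apply: lee_wpmul2r; first exact: Lpw_norm_ge0.
  by rewrite lee_fin ler_norm.
- apply: hCa => [|t]; last by rewrite mulr_ge0 ?powR_ge0 ?rnorm_ge0.
  by apply: measurable_funM; [exact: measurable_powR|exact: sm_rnorm].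
- apply: hCb => [|t]; last by rewrite mulr_ge0 ?powR_ge0 ?rnorm_ge0.
  by apply: measurable_funM; [exact: measurable_powR|exact: sm_rnorm].
Qed.

(** It remains to replace [u] by a separably measurable representative, which changes neither norms
    nor convolutions, and to return from [p]-th powers to norms. *)
Lemma convolution_transfer :
  bounded_convolution p a K -> bounded_convolution p b K.
Proof.
move=> /convolution_transfer_sm[C hC].
(* [C] has no sign; its absolute value keeps the estimate and allows a [p]-th root. *)
exists (`|C| `^ p^-1) => u uL; have [smRu ufin] := (in_LpwP _ _ p0).1 uL.
have [u0 smu0 uu0] := (strongly_measurableP leb _ mR).1 smRu.
have normE : Lpw_norm p b u = Lpw_norm p b u0.
  by apply: Lpw_norm_ae_eq => //; apply: ae_imply uu0 => t h /h ->.
have u0L : in_Lpw p b u0.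
  apply/(in_LpwP _ _ p0); split.
    by apply/(strongly_measurableP leb _ mR); exists u0 => //; exact: aeW.
  by apply/(Lpw_norm_lty _ _ p0); rewrite -normE; apply/(Lpw_norm_lty _ _ p0).
have [_ u0fin] := (in_LpwP _ _ p0).1 u0L.
have [v [cv smv vle]] := hC u0 smu0 u0L; exists v.
have IG0 : (0 <= \int[leb]_(t in Rplus) ((t `^ b * rnorm (u0 t)) `^ p)%:E)%E.
  by apply: integral_ge0 => t _; rewrite lee_fin powR_ge0.
have vle' := le_trans vle (lee_wpmul2r IG0 (_ : (C%:E <= `|C|%:E)%E)).
have {vle'} := vle' (ler_norm C) => vle'.
split.
- apply: ae_imply cv => t h t0; apply: convolution_ae_eq (h t0).
  by apply: ae_imply uu0 => s us s0; rewrite us//= in_itv/= andbT.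
- apply/(in_LpwP _ _ p0); split; first exact: smv.
  by apply: (le_lt_trans vle'); rewrite lte_mul_pinfty// lee_fin.
- rewrite normE !Lpw_normE// -poweR_EFin -poweRM ?lee_fin//.
  apply: le_poweR; [by rewrite invr_ge0 ltW| |exact: vle'].
  by apply: integral_ge0 => t _; rewrite lee_fin powR_ge0.
Qed.

End BoundedTransfer.

Lemma linear_0 {K : pzRingType} {V W : lmodType K} (f : V -> W) : linear f -> f 0 = 0.
Proof.
move=> /(_ 1 0 0); rewrite !scale1r addr0 => h.
by apply: (addrI (f 0)); rewrite addr0.
Qed.

Lemma linear_Z {K : pzRingType} {V W : lmodType K} (f : V -> W) c x :
  linear f -> f (c *: x) = c *: f x.
Proof. by move=> fl; have := fl c x 0; rewrite (linear_0 fl) !addr0. Qed.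

(** * Homogeneity of the kernel *)

Section Extrapolation.
Context {R : realType} {X : normedModType R[i]}.
Variables (T : R -> X -> X) (A : X -> X -> Prop).
Hypothesis T_lin : forall h, 0 <= h -> linear (T h).
Hypothesis A_generator : forall x y, A x y <-> generator T x (- y).

Lemma generator_scale c x y : A x y -> A (c *: x) (c *: y).
Proof.
move=> /A_generator xy; apply/A_generator; rewrite /generator -[X in _ --> X]scalerN.
have cxy : c *: ((h^-1)%:C%C *: (T h x - x)) @[h --> 0^'+] --> c *: - y.
  by apply: (@cvgZ _ _ _ _ _ (cst c)); [exact: cvg_cst|exact: xy].
apply: cvg_trans cxy; apply: near_eq_cvg; near=> h.
have h0 : 0 <= h by apply: ltW.
by rewrite (linear_Z _ _ (T_lin h0)) -scalerBr !scalerA mulrC.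
Unshelve. all: by end_near.
Qed.

Lemma generator_0 : A 0 0.
Proof.
apply/A_generator; rewrite oppr0 /generator.
apply: cvg_near_cst; near=> h; have h0 : 0 <= h by apply: ltW.
by rewrite (linear_0 (T_lin h0)) subrr scaler0.
Unshelve. all: by end_near.
Qed.

(** [A] is a graph; at 0 it is single-valued because limits are unique. *)
Lemma generator_0_uniq y : A 0 y -> y = 0.
Proof.
move=> /A_generator y0; have /A_generator z0 := generator_0.
by apply: oppr_inj; apply: cvg_unique y0 z0.
Qed.

Lemma op_pow_scale k c x y : op_pow A k x y -> op_pow A k (c *: x) (c *: y).
Proof.
elim: k y => [y <-//|k IH y /= [z /IH xz zy]].
by exists (c *: z) => //; exact: generator_scale.
Qed.

Lemma op_pow_0 k : op_pow A k 0 0.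
Proof. by elim: k => [//|k IH /=]; exists 0 => //; exact: generator_0. Qed.

Lemma op_pow_id_plus_0 k x : op_pow (id_plus A) k 0 x -> x = 0.
Proof.
elim: k x => [x <-//|k IH x /= [z /IH ->]].
by rewrite /id_plus subr0 => /generator_0_uniq.
Qed.

(** If [iota x = 0], the element [y] with [(Id + A)^k y = x] has norm 0, so [x] is a value of
    [(Id + A)^k] at 0. This determines the preimage on which [CTB] evaluates [C]. *)
Lemma is_Xmk_inj k (Z : completeNormedModType R[i]) (iota : X -> Z) :
  is_Xmk A k iota -> injective iota.
Proof.
move=> [iota_lin _ iota_norm].
have iota0 x : iota x = 0 -> x = 0.
  move=> ix; have [y yx xy] := iota_norm x.
  move: xy; rewrite ix rnorm0 => /esym/eqP; rewrite rnorm_eq0 => /eqP y0.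
  by move: yx; rewrite y0 => /op_pow_id_plus_0.
move=> x y xy; apply/eqP; rewrite -subr_eq0; apply/eqP/iota0.
by have := iota_lin (-1) y x; rewrite !scaleN1r xy addNr addrC.
Qed.

(* If [Tm t (B u)] is not in the range of [iota] on the domain of [A ^ k], then [CTB]
   takes the junk value [C 0 = 0], at [u] and at all its nonzero multiples. *)
Lemma CTB_scale k (Z : completeNormedModType R[i]) (U Y : normedModType R[i])
    (iota : X -> Z) (Tm : R -> Z -> Z) (C : X -> Y) (B : U -> Z) t (c : R[i]) u :
  is_Xmk A k iota -> linear (Tm t) -> linear B -> bounded_on_Xk A k C ->
  CTB A k iota Tm C B t (c *: u) = c *: CTB A k iota Tm C B t u.
Proof.
move=> XmkZ Tm_lin B_lin [C_lin _]; have iota_inj := is_Xmk_inj XmkZ.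
have [iota_lin _ _] := XmkZ.
have dom0 : op_dom (op_pow A k) 0 by exists 0; exact: op_pow_0.
have C0 : C 0 = 0.
  have := C_lin 1 0 0 dom0 dom0; rewrite !scale1r addr0 => h.
  by apply: (addrI (C 0)); rewrite addr0.
have CZ d x : op_dom (op_pow A k) x -> C (d *: x) = d *: C x.
  by move=> xd; have := C_lin d x 0 xd dom0; rewrite C0 !addr0.
pose S v : set X := [set x | op_dom (op_pow A k) x /\ iota x = Tm t (B v)].
have S_scale d v x : S v x -> S (d *: v) (d *: x).
  move=> [[y xy] ix]; split; first by exists (d *: y); exact: op_pow_scale.
  by rewrite (linear_Z _ _ iota_lin) ix (linear_Z _ _ B_lin) (linear_Z _ _ Tm_lin).
have S_uniq v x y : S v x -> S v y -> y = x.
  by move=> [_ ix] [_ iy]; apply: iota_inj; rewrite ix iy.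
have xgetS v x : S v x -> xget 0 (S v) = x.
  by move=> Svx; apply: xget_unique => // y; exact: S_uniq.
rewrite /CTB -!/(S _).
have [[x Sx]|nS] := pselect (exists x, S u x).
  by rewrite (xgetS _ _ Sx) (xgetS _ _ (S_scale c _ _ Sx)) CZ//; case: Sx.
rewrite (xgetPN 0 (P := S u)); last by move=> x Sx; apply: nS; exists x.
rewrite C0 scaler0; have [->|c0] := eqVneq c 0.
  (* Even when [S u] is empty, [S 0] contains 0, and [C] vanishes there. *)
  rewrite scale0r (@xgetS _ 0) ?C0//; split => //.
  by rewrite (linear_0 iota_lin) (linear_0 B_lin) (linear_0 Tm_lin).
rewrite xgetPN ?C0// => x /(S_scale c^-1); rewrite scalerA mulVf// scale1r => Sx.
by apply: nS; exists (c^-1 *: x).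
Qed.

End Extrapolation.

Theorem theorem1p13 (R : realType) (p p' alpha : R) (k : nat)
    (X U Y : completeNormedModType R[i])
    (T : R -> X -> X) (A : X -> X -> Prop)
    (Z : completeNormedModType R[i]) (iota : X -> Z) (Tm : R -> Z -> Z)
    (C : X -> Y) (B : U -> Z) (M : R) :
  1 < p -> p^-1 + p'^-1 = 1 -> - p^-1 < alpha < p'^-1 -> (1 <= k)%N ->
  (* T is a bounded analytic semigroup with generator -A *)
  bounded_analytic_semigroup T ->
  (forall x y, A x y <-> generator T x (- y)) ->
  (* Z is X_{-k} and Tm is T_{-k} *)
  is_Xmk A k iota ->
  C0_semigroup Tm -> bounded_semigroup Tm ->
  (forall t x, 0 <= t -> Tm t (iota x) = iota (T t x)) ->
  bounded_on_Xk A k C -> bounded_linear B ->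
  0 < M ->
  (forall t, 0 < t -> forall u,
     rnorm (CTB A k iota Tm C B t u) <= M / t * rnorm u) ->
  bounded_convolution p alpha (CTB A k iota Tm C B) <->
  bounded_convolution p 0 (CTB A k iota Tm C B).
Proof.
move=> p1 pp' /andP[ap ap'] _ [[T0 _ _ _] _] AT XmkZ [Tm0 _ _ _] _ _ CXk [B_lin _] M0 K_le.
have p0 : 0 < p by apply: lt_trans p1.
(* [p'] is given through its inverse; [1 < p] makes [p'^-1 = 1 - p^-1] positive. This is also the
   condition on the weight 0. *)
have p'V0 : 0 < p'^-1 by rewrite -(addKr p^-1 p'^-1) pp' addrC subr_gt0 invf_lt1.
have p'0 : 0 < p' by rewrite -invr_gt0.
have T_lin h : 0 <= h -> linear (T h) by move=> /T0[].
have K_scale (t c : R) (u : U) : 0 < t ->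
    CTB A k iota Tm C B t (c%:C%C *: u) = c%:C%C *: CTB A k iota Tm C B t u.
  by move=> /ltW/Tm0[Tm_lin _]; exact: (CTB_scale T_lin AT _ _ XmkZ Tm_lin B_lin CXk).
by split; apply: (convolution_transfer M0 K_scale _ p0 p'0 pp') => // t u /K_le.
Qed.
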